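(* Let $A$ and $B$ be $C^*$-algebras and suppose that ${}_AX_B$ is an $A$--$B$ imprimitivity bimodule. Then $A$ is liminary if and only if $B$ is liminary.
   Context: An $A$--$B$ imprimitivity bimodule ${}_AX_B$ is an $A$--$B$ bimodule which is a full left Hilbert $A$-module (inner product ${}_A\langle\cdot,\cdot\rangle$) and a full right Hilbert $B$-module (inner product $\langle\cdot,\cdot\rangle_B$), such that $A$ acts by adjointable operators on $X_B$, $B$ acts by adjointable operators on ${}_AX$, and ${}_A\langle x,y\rangle\cdot z=x\cdot\langle y,z\rangle_B$. A $C^*$-algebra $A$ is liminary (also called CCR) if, for every irreducible representation $\pi$ of $A$ on a Hilbert space $H_\pi$, $\pi(A)$ is the algebra $\mathcal K(H_\pi)$ of compact operators on $H_\pi$. *)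

(* Defs.v *)
From HB Require Import structures.
From mathcomp Require Import all_boot all_order all_algebra sesquilinear.
From mathcomp Require Import complex.
From mathcomp Require Import all_classical all_reals all_analysis.

Set Implicit Arguments.
Unset Strict Implicit.
Unset Printing Implicit Defensive.

Import Order.TTheory GRing.Theory Num.Theory Num.Def.
Import numFieldNormedType.Exports.

Local Open Scope classical_set_scope.
Local Open Scope complex_scope.
Local Open Scope ring_scope.

(* The scalars are R[i], with R : realType.  Norms take their values in R[i]
   too; there 0 <= z means that z is a nonnegative real number. *)

(* Not necessarily unital, and possibly zero. *)
Record cstarAlgebra (R : realType) := CStarAlgebra {
  cstar_carrier :> completeNormedModType R[i] ;
  cmul : {bilinear cstar_carrier -> cstar_carrier -> cstar_carrier} ;
  cstar : {linear cstar_carrier -> cstar_carrier | conjC \; *:%R} ;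
  cmulA : associative cmul ;
  cstarK : involutive cstar ;
  cstarM : forall a b, cstar (cmul a b) = cmul (cstar b) (cstar a) ;
  cnormM_le : forall a b, `|cmul a b| <= `|a| * `|b| ;
  cnorm_star_mul : forall a, `|cmul (cstar a) a| = `|a| ^+ 2
}.
Arguments cmul {R c}.
Arguments cstar {R c}.

Definition cpositive (R : realType) (A : cstarAlgebra R) (a : A) : Prop :=
  exists c : A, a = cmul (cstar c) c.

(* {dot H for conjC}: linear in the first variable, positive definite. *)
Record hilbertSpace (R : realType) := HilbertSpace {
  hilbert_carrier :> completeNormedModType R[i] ;
  hdot : {dot hilbert_carrier for conjC} ;
  hdot_norm : forall x, `|x| ^+ 2 = hdot x x
}.
Arguments hdot {R h}.

(* Boundedness of T follows from precompactness of the image of the unit ball. *)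
Definition compact_operators (R : realType) (H : hilbertSpace R) :
    set (H -> H) :=
  [set T | linear T /\ precompact (T @` [set x | `|x| <= 1])].

Record is_representation (R : realType) (A : cstarAlgebra R)
    (H : hilbertSpace R) (pi : {bilinear A -> H -> H}) : Prop := {
  rep_continuous : forall a, continuous (pi a) ;
  rep_mul : forall a b x, pi (cmul a b) x = pi a (pi b x) ;
  rep_star : forall a x y, hdot (pi a x) y = hdot x (pi (cstar a) y)
}.

(* Irreducibility includes pi <> 0, which excludes both H = 0 and the zero
   representation on a one-dimensional space. *)
Record is_irreducible (R : realType) (A : cstarAlgebra R)
    (H : hilbertSpace R) (pi : {bilinear A -> H -> H}) : Prop := {
  irr_representation : is_representation pi ;
  irr_nonzero : exists a x, pi a x != 0 ;
  irr_invariant : forall V : set H,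
    closed V ->
    V 0 -> (forall (c : R[i]) x y, V x -> V y -> V (c *: x + y)) ->
    (forall a x, V x -> V (pi a x)) ->
    V = [set 0] \/ V = [set: H]
}.

Definition liminary (R : realType) (A : cstarAlgebra R) : Prop :=
  forall (H : hilbertSpace R) (pi : {bilinear A -> H -> H}),
    is_irreducible pi ->
    range (fun a => pi a : H -> H) = @compact_operators R H.

Definition linear_span (R : realType) (V : lmodType R[i]) (S : set V) : set V :=
  [set v | exists (n : nat) (c : 'I_n -> R[i]) (u : 'I_n -> V),
    (forall i, S (u i)) /\ v = \sum_(i < n) c i *: u i].

Definition norm_complete (R : realType) (V : zmodType) (N : V -> R[i]) : Prop :=
  forall u : nat -> V,
    (forall e : R[i], 0 < e -> exists k : nat, forall m n : nat,
      (k <= m)%N -> (k <= n)%N -> N (u m - u n) < e) ->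
    exists l : V, forall e : R[i], 0 < e -> exists k : nat, forall n : nat,
      (k <= n)%N -> N (u n - l) < e.

Record is_full_left_hilbert (R : realType) (A : cstarAlgebra R)
    (X : lmodType R[i]) (act : {bilinear A -> X -> X})
    (ip : {bilinear X -> X -> A | *:%R & conjC \; *:%R}) : Prop := {
  lh_actA : forall a b x, act (cmul a b) x = act a (act b x) ;
  lh_ip_act : forall a x y, ip (act a x) y = cmul a (ip x y) ;
  lh_ip_star : forall x y, cstar (ip x y) = ip y x ;
  lh_ip_ge0 : forall x, cpositive (ip x x) ;
  lh_ip_eq0 : forall x, ip x x = 0 -> x = 0 ;
  lh_complete : norm_complete (fun x => sqrtC `|ip x x|) ;
  lh_full : closure (linear_span [set ip z.1 z.2 | z in [set: X * X]])
            = [set: A]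
}.

Record is_full_right_hilbert (R : realType) (B : cstarAlgebra R)
    (X : lmodType R[i]) (act : {bilinear X -> B -> X})
    (ip : {bilinear X -> X -> B | conjC \; *:%R & *:%R}) : Prop := {
  rh_actA : forall x b c, act x (cmul b c) = act (act x b) c ;
  rh_ip_act : forall x y b, ip x (act y b) = cmul (ip x y) b ;
  rh_ip_star : forall x y, cstar (ip x y) = ip y x ;
  rh_ip_ge0 : forall x, cpositive (ip x x) ;
  rh_ip_eq0 : forall x, ip x x = 0 -> x = 0 ;
  rh_complete : norm_complete (fun x => sqrtC `|ip x x|) ;
  rh_full : closure (linear_span [set ip z.1 z.2 | z in [set: X * X]])
            = [set: B]
}.

Definition adjointable (X D : Type) (ip : X -> X -> D) (T : X -> X) : Prop :=
  exists S : X -> X, forall x y, ip (T x) y = ip x (S y).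

Record imprimitivityBimodule (R : realType) (A B : cstarAlgebra R) :=
    ImprimitivityBimodule {
  ib_carrier :> lmodType R[i] ;
  lact : {bilinear A -> ib_carrier -> ib_carrier} ;
  ract : {bilinear ib_carrier -> B -> ib_carrier} ;
  lip : {bilinear ib_carrier -> ib_carrier -> A | *:%R & conjC \; *:%R} ;
  rip : {bilinear ib_carrier -> ib_carrier -> B | conjC \; *:%R & *:%R} ;
  ib_actA : forall a x b, ract (lact a x) b = lact a (ract x b) ;
  ib_left : is_full_left_hilbert lact lip ;
  ib_right : is_full_right_hilbert ract rip ;
  ib_lact_adjointable : forall a, adjointable rip (lact a) ;
  ib_ract_adjointable : forall b, adjointable lip (fun x => ract x b) ;
  ib_ipA : forall x y z, lact (lip x y) z = ract x (rip y z)
}.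

(* Main.v *)
(** Let pi be an irreducible representation of B on H and xi <> 0 in H.  Since
    xi is cyclic, completing X for the form [x, y] = <pi(<y, x>_B) xi, xi> yields
    the Hilbert space K = X (x)_B H of Rieffel's induction, without forming a
    tensor product, and A acts irreducibly on it.  The operators
    F_x : z |-> x (x) z from H to K and their adjoints T_x satisfy
    F_x T_y = <x, y>_A on K and T_x F_y = pi(<x, y>_B) on H.
    Let A be liminary.  The F_x T_x are compact, hence so are the T_x, the
    pi(<x, y>_B) and, by density, pi(B).  Conversely the rank one operators on K
    come from A, hence T_x A F_x = pi(<x, A x>_B) contains a rank one operator;
    by irreducibility pi(B) then contains every rank one operator up to
    arbitrarily small errors, and as it is closed it contains every compact
    operator.  The other implication is the same one for the conjugate of X.

    Two facts usually deduced from the continuous functional calculus are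
    obtained by hand: the boundedness of the action of A, from a square root of
    1 - h found by a contraction, and the closedness of pi(B), from the polynomial
    sine ((1 + i t h / n)^n - (1 - i t h / n)^n) / (2 i), which is almost a
    contraction for self-adjoint h and large n. *)

(* Only an approximate Riesz theorem is proved, so a bounded operator does not come with an adjoint.
   This shapes the argument twice. The operators [F_x] and [T_x] are built separately, each on a
   dense subspace, and the relations between them are checked there and carried over by Lipschitz
   continuity. Moreover, a rank one operator composed with a bounded T is reached only as a limit,
   so the closedness of pi(B) is used already for finite rank operators. Closedness rests on a weak
   substitute for the isometry of the quotient by the kernel: an element whose image has norm at
   most M is replaced by one of norm at most 36 M whose image is off by at most M / 4. The size of
   36 is irrelevant; since the error shrinks geometrically, the successive corrections are
   summable. *)
Require Import Defs.
From HB Require Import structures.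
From mathcomp Require Import all_boot all_order all_algebra sesquilinear.
From mathcomp Require Import complex ring lra.
From mathcomp Require Import all_classical all_reals all_analysis.

Set Implicit Arguments.
Unset Strict Implicit.
Unset Printing Implicit Defensive.

Import Order.TTheory GRing.Theory Num.Theory Num.Def.
Import numFieldNormedType.Exports.

Local Open Scope classical_set_scope.
Local Open Scope complex_scope.
Local Open Scope ring_scope.

(** * Real-valued norms and filter-free topology *)

Section RealNorm.
Variable R : realType.
Local Notation C := R[i].

Lemma conjcM (z w : C) : ((z * w)^*)%C = (z^*)%C * (w^*)%C.
Proof. exact: rmorphM. Qed.

Lemma conjcD (z w : C) : ((z + w)^*)%C = (z^*)%C + (w^*)%C.
Proof. exact: rmorphD. Qed.

Lemma conjcN (z : C) : ((- z)^*)%C = - (z^*)%C.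
Proof. exact: rmorphN. Qed.

(** The norms of the statement lie in R[i]; their real parts put every estimate in an ordered field,
    where [lra] and [nra] apply. *)
Definition nrm (V : normedZmodType C) (v : V) : R := complex.Re `|v|.

Lemma nrmE (V : normedZmodType C) (v : V) : `|v| = (nrm v)%:C.
Proof. by rewrite /nrm RRe_real// ger0_real. Qed.

Lemma nrm_ge0 (V : normedZmodType C) (v : V) : 0 <= nrm v.
Proof. by rewrite -ler0c -nrmE. Qed.

Lemma nrm0 (V : normedZmodType C) : nrm (0 : V) = 0.
Proof. by rewrite /nrm normr0. Qed.

Lemma nrm_eq0 (V : normedZmodType C) (v : V) : nrm v = 0 -> v = 0.
Proof. by move=> h; apply/normr0_eq0; rewrite nrmE h. Qed.

Lemma nrm_gt0 (V : normedZmodType C) (v : V) : v != 0 -> 0 < nrm v.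
Proof.
move=> v0; rewrite lt_neqAle nrm_ge0 andbT eq_sym.
by apply: contra v0 => /eqP/nrm_eq0 ->.
Qed.

Lemma nrmN (V : normedZmodType C) (v : V) : nrm (- v) = nrm v.
Proof. by rewrite /nrm normrN. Qed.

Lemma nrmB (V : normedZmodType C) (v w : V) : nrm (v - w) = nrm (w - v).
Proof. by rewrite /nrm distrC. Qed.

Lemma nrmD_le (V : normedZmodType C) (v w : V) : nrm (v + w) <= nrm v + nrm w.
Proof. by rewrite -lecR rmorphD/= -!nrmE ler_normD. Qed.

Lemma nrmB_le (V : normedZmodType C) (v w : V) : nrm (v - w) <= nrm v + nrm w.
Proof. by rewrite -(nrmN w) nrmD_le. Qed.

Lemma nrm_dist (V : normedZmodType C) (u v w : V) :
  nrm (v - w) <= nrm (v - u) + nrm (u - w).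
Proof. by rewrite -[v - w](subrKA u) nrmD_le. Qed.

Lemma nrmM (z w : C) : nrm (z * w) = nrm z * nrm w.
Proof. by rewrite /nrm normrM nrmE [`|w|]nrmE -rmorphM. Qed.

Lemma nrmZ (V : normedModType C) (z : C) (v : V) : nrm (z *: v) = nrm z * nrm v.
Proof. by rewrite /nrm normrZ nrmE [`|v|]nrmE -rmorphM. Qed.

Lemma nrm_real (x : R) : 0 <= x -> nrm (x%:C : C) = x.
Proof. by move=> x0; rewrite /nrm ger0_norm ?ler0c. Qed.

Lemma nrm_conj (z : C) : nrm (z^*%C) = nrm z.
Proof. by rewrite /nrm normcJ. Qed.

Lemma nrm_sqr (z : C) : (nrm z ^+ 2)%:C = z * (z^*)%C.
Proof. by rewrite rmorphXn/= -nrmE sqr_normc. Qed.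

Lemma Re_nrm (z : C) : `|complex.Re z| <= nrm z.
Proof. by rewrite -lecR -nrmE; exact: normc_ge_Re. Qed.

Lemma Re_le_nrm (z : C) : complex.Re z <= nrm z.
Proof. exact: le_trans (ler_norm _) (Re_nrm z). Qed.

Lemma Im_nrm (z : C) : `|complex.Im z| <= nrm z.
Proof.
case: z => a b /=; rewrite /nrm normc_def/= -sqrtr_sqr ler_sqrt.
  by rewrite lerDr sqr_ge0.
by rewrite addr_ge0 ?sqr_ge0.
Qed.

Lemma nrm_le_ReIm (z : C) : nrm z <= `|complex.Re z| + `|complex.Im z|.
Proof.
rewrite {1}[z]complexE; apply: le_trans (nrmD_le _ _) _; rewrite nrmM.
rewrite /nrm !normc_def/= expr0n/= !addr0 !add0r !expr1n sqrtr1 mul1r.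
by rewrite !sqrtr_sqr.
Qed.

Lemma ball_nrm (V : normedModType C) (v w : V) (e : R) :
  ball v (e%:C) w <-> nrm (v - w) < e.
Proof. by rewrite -ball_normE /ball_/= nrmE ltcR. Qed.

Lemma posC (e : C) : 0 < e -> exists2 r : R, 0 < r & e = r%:C.
Proof.
by move=> e0; exists (complex.Re e); [move: e0; rewrite ltcE => /andP[]|];
  rewrite ?RRe_real// gtr0_real.
Qed.

Lemma nbhs_nrm (V : normedModType C) (v : V) (P : set V) :
  nbhs v P <-> exists2 e : R, 0 < e & forall w, nrm (v - w) < e -> P w.
Proof.
rewrite -nbhs_ballE; split=> -[e e0 He].
  have [r r0 re] := posC e0; exists r => // w /ball_nrm; rewrite -re; exact: He.
by exists e%:C; rewrite /= ?ltcR// => w /ball_nrm; apply: He.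
Qed.

Lemma closed_nrm (V : normedModType C) (S : set V) : closed S <->
  (forall v, (forall e : R, 0 < e -> exists2 w, S w & nrm (v - w) < e) -> S v).
Proof.
split=> [cS v Sv|cS v].
  apply: cS => P /nbhs_nrm[e e0 He]; have [w Sw vw] := Sv e e0.
  by exists w; split=> //; apply: He.
move=> clv; apply: cS => e e0.
have [|w [Sw vw]] := clv [set w | nrm (v - w) < e]; last by exists w.
by apply/nbhs_nrm; exists e.
Qed.

Lemma closure_nrm (V : normedModType C) (S : set V) (v : V) : closure S v <->
  (forall e : R, 0 < e -> exists2 w, S w & nrm (v - w) < e).
Proof.
split=> [clv e e0|Sv P /nbhs_nrm[e e0 He]].
  have [|w [Sw vw]] := clv [set w | nrm (v - w) < e]; last by exists w.
  by apply/nbhs_nrm; exists e.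
by have [w Sw vw] := Sv e e0; exists w; split=> //; apply: He.
Qed.

Lemma nrm_small (V : normedZmodType C) (v : V) :
  (forall e : R, 0 < e -> nrm v <= e) -> v = 0.
Proof.
move=> h; apply: nrm_eq0; apply/eqP; rewrite eq_le nrm_ge0 andbT.
by apply/ler_addgt0Pl => e e0; rewrite addr0 h.
Qed.

Lemma nrm_complete (V : completeNormedModType C) (u : nat -> V) :
  (forall e : R, 0 < e -> exists N, forall m n, (N <= m)%N -> (N <= n)%N ->
     nrm (u m - u n) < e) ->
  exists l, forall e : R, 0 < e -> exists N, forall n, (N <= n)%N ->
     nrm (u n - l) < e.
Proof.
move=> uC.
have : cauchy (u @ \oo).
  apply/cauchy_exP => _/posC[e e0 ->]; have [N HN] := uC e e0.
  by exists (u N); exists N => // n /= Nn; apply/ball_nrm; apply: HN.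
move/cauchy_cvg => cu; exists (lim (u @ \oo)) => e e0.
have /= [|N _ HN] := cu [set w | nrm (w - lim (u @ \oo)) < e].
  by apply/nbhs_nrm; exists e => // w; rewrite nrmB.
by exists N => n /HN.
Qed.

Lemma bound_continuous (V W : normedModType C) (f : {linear V -> W}) (M : R) :
  (forall v, nrm (f v) <= M * nrm v) -> continuous f.
Proof.
move=> H; apply/linear_bounded_continuous/linear_boundedP.
near=> r => v; apply: (@le_trans _ _ (`|M|%:C * `|v|)).
  rewrite !nrmE -rmorphM lecR; apply: le_trans (H v) _.
  by rewrite ler_wpM2r ?nrm_ge0// ler_norm.
rewrite ler_wpM2r//; near: r; apply: nbhs_pinfty_ge.
by apply/complex_realP; exists `|M|.
Unshelve. all: by end_near. Qed.

Definition totally_bounded (V : normedModType C) (S : set V) :=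
  forall e : R, 0 < e ->
    exists s : seq V, forall v, S v -> exists2 p, p \in s & nrm (v - p) < e.

(** Forward, finitely many open balls cover the compact closure. Backward, an ultrafilter containing
    the closure of S contains a ball of every radius, hence is Cauchy and converges by
    completeness. *)
Lemma precompact_totally_bounded (V : completeNormedModType C) (S : set V) :
  precompact S <-> totally_bounded S.
Proof.
rewrite precompactE; split=> [|tb].
  rewrite compact_cover => cS e e0.
  have [|v clv|D _ HD] := cS V setT (fun p => [set v | nrm (v - p) < e]).
  - move=> p _; rewrite openE => v /= ve; apply/nbhs_nrm.
    exists (e - nrm (v - p)); rewrite ?subr_gt0// => w vw.
    apply: le_lt_trans (nrm_dist v _ _) _.
    by rewrite [nrm (w - v)]nrmB -ltrBrDr.
  - by exists v => //=; rewrite subrr nrm0.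
  exists (finmap.enum_fset D) => v Sv.
  have [p pD vp] := HD v (subset_closure Sv); by exists p.
rewrite compact_ultra => F FU FS.
have FF : ProperFilter F := @ultra_proper _ _ FU.
have : cauchy F.
  apply/cauchy_exP => _/posC[e e0 ->].
  have e20 : 0 < e / 2 by rewrite divr_gt0.
  have [s Hs] := tb _ e20.
  have : F [set v | exists2 p, p \in s & nrm (p - v) < e].
    apply: filterS FS => v /closure_nrm/(_ _ e20)[w /Hs[p ps wp] vw].
    exists p => //=; apply: le_lt_trans (nrm_dist w _ _) _.
    by rewrite [nrm (p - w)]nrmB [nrm (w - v)]nrmB [ltRHS](splitr e) ltrD.
  (* An ultrafilter containing a finite union of balls contains the first ball or the union of the
     others. *)
  elim: s {Hs} => [|p s IH] Fs.
    by exfalso; apply: (@filter_not_empty _ F FF); apply: filterS Fs => v [].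
  have [Fp|Fp] := in_ultra_setVsetC [set v | nrm (p - v) < e] FU.
    by exists p; apply: filterS Fp => v /= ?; apply/ball_nrm.
  apply: IH; apply: filterS2 Fp Fs => v /= pv [q].
  by rewrite inE => /orP[/eqP->//|qs qv]; exists q.
move/cauchy_cvg => cF; exists (lim F); split=> //.
have /closed_nrm := @closed_closure _ S; apply => e e0.
have : F [set w | nrm (lim F - w) < e].
  by apply: cF; apply/nbhs_nrm; exists e.
move=> /(filterI FS)/filter_ex[w [clw lw]]; by exists w.
Qed.

End RealNorm.

(** * Completion of a semi-inner product space *)

Section SemiInnerProduct.
Variables (R : realType) (E : lmodType R[i]).
Local Notation C := R[i].

Record semi_ip (s : E -> E -> C) : Prop := SemiIp {
  sip_linear : forall c x y z, s (c *: x + y) z = c * s x z + s y z ;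
  sipC : forall x y, s y x = ((s x y)^*)%C ;
  sip_ge0 : forall x, 0 <= s x x
}.

Definition snrm (s : E -> E -> C) (x : E) : R := Num.sqrt (complex.Re (s x x)).

Variables (s : E -> E -> C) (hs : semi_ip s).

Lemma sip0l x : s 0 x = 0.
Proof. by have := sip_linear hs (-1) 0 0 x; rewrite scaler0 addr0 mulN1r addNr. Qed.

Lemma sipDl x y z : s (x + y) z = s x z + s y z.
Proof. by have := sip_linear hs 1 x y z; rewrite scale1r mul1r. Qed.

Lemma sipZl c x z : s (c *: x) z = c * s x z.
Proof. by have := sip_linear hs c x 0 z; rewrite addr0 sip0l addr0. Qed.

Lemma sipNl x z : s (- x) z = - s x z.
Proof. by rewrite -scaleN1r sipZl mulN1r. Qed.

Lemma sipBl x y z : s (x - y) z = s x z - s y z.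
Proof. by rewrite sipDl sipNl. Qed.

Lemma sip0r x : s x 0 = 0.
Proof. by rewrite (sipC hs) sip0l conjc0. Qed.

Lemma sipDr x y z : s x (y + z) = s x y + s x z.
Proof. by rewrite !(sipC hs _ x) sipDl conjcD. Qed.

Lemma sipZr c x z : s x (c *: z) = (c^*)%C * s x z.
Proof. by rewrite !(sipC hs _ x) sipZl conjcM. Qed.

Lemma sipNr x z : s x (- z) = - s x z.
Proof. by rewrite !(sipC hs _ x) sipNl conjcN. Qed.

Lemma sipBr x y z : s x (y - z) = s x y - s x z.
Proof. by rewrite sipDr sipNr. Qed.

Lemma snrm_ge0 x : 0 <= snrm s x. Proof. exact: sqrtr_ge0. Qed.

Lemma snrmE x : s x x = (snrm s x ^+ 2)%:C.
Proof.
have s0 := sip_ge0 hs x; rewrite sqr_sqrtr ?RRe_real ?ger0_real//.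
by rewrite -ler0c RRe_real ?ger0_real.
Qed.

Lemma cauchy_schwarz x y : nrm (s x y) <= snrm s x * snrm s y.
Proof.
set m := nrm (s x y); set a := snrm s x; set b := snrm s y.
have m0 : 0 <= m := nrm_ge0 _.
have a0 : 0 <= a := snrm_ge0 _; have b0 : 0 <= b := snrm_ge0 _.
(* Positivity at x - t s(x, y) y, with t real, gives a real quadratic in t. *)
have H (t : R) : 0 <= a ^+ 2 - 2 * t * m ^+ 2 + t ^+ 2 * m ^+ 2 * b ^+ 2.
  have /= := sip_ge0 hs (x - (t%:C * s x y) *: y).
  rewrite sipBl !sipBr !sipZl !sipZr conjcM conjc_real !snrmE -/a -/b [s y x](sipC hs).
  set z := s x y; set w := (_^*)%C.
  suff -> : (a ^+ 2)%:C - t%:C * w * z -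
     (t%:C * z * w - t%:C * z * (t%:C * w * (b ^+ 2)%:C)) =
     (a ^+ 2 - 2 * t * m ^+ 2 + t ^+ 2 * m ^+ 2 * b ^+ 2)%:C.
    by rewrite ler0c.
  have hm : (m ^+ 2)%:C = z * w by rewrite nrm_sqr.
  transitivity ((a ^+ 2)%:C - 2 * t%:C * (z * w) +
    t%:C ^+ 2 * (z * w) * (b ^+ 2)%:C); first by ring.
  rewrite -hm; ring.
have [b_0|bn0] := eqVneq b 0.
  rewrite b_0 mulr0; have [->//|mn0] := eqVneq m 0.
  (* For b = 0 the quadratic is affine in t, and this t gives it the value -1. *)
  have := H ((a ^+ 2 + 1) / (2 * m ^+ 2)).
  rewrite b_0 expr0n/= mulr0 addr0.
  have -> : 2 * ((a ^+ 2 + 1) / (2 * m ^+ 2)) * m ^+ 2 = a ^+ 2 + 1.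
    by field; rewrite mn0.
  lra.
rewrite -ler_sqr ?nnegrE ?mulr_ge0// exprMn.
(* The minimum of the quadratic. *)
have := H (b ^- 2).
have -> : a ^+ 2 - 2 * b ^- 2 * m ^+ 2 + b ^- 2 ^+ 2 * m ^+ 2 * b ^+ 2 =
  (a ^+ 2 * b ^+ 2 - m ^+ 2) / b ^+ 2 by field.
by rewrite pmulr_lge0 ?subr_ge0// invr_gt0 exprn_even_gt0.
Qed.

Lemma snrm_le (x : E) (M : R) : 0 <= M -> (snrm s x <= M) = (complex.Re (s x x) <= M ^+ 2).
Proof. by move=> M0; rewrite snrmE/= ler_sqr ?nnegrE ?snrm_ge0. Qed.

Lemma snrmD_le x y : snrm s (x + y) <= snrm s x + snrm s y.
Proof.
rewrite snrm_le ?addr_ge0 ?snrm_ge0//.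
rewrite sipDl !sipDr !snrmE.
have h1 := le_trans (Re_le_nrm _) (cauchy_schwarz x y).
have h2 := le_trans (Re_le_nrm _) (cauchy_schwarz y x).
rewrite !raddfD/=; lra.
Qed.

Lemma snrmZ c x : snrm s (c *: x) = nrm c * snrm s x.
Proof.
rewrite {1}/snrm sipZl sipZr mulrA -nrm_sqr snrmE -rmorphM/= -exprMn sqrtr_sqr.
by rewrite ger0_norm ?mulr_ge0 ?nrm_ge0 ?snrm_ge0.
Qed.

Lemma snrm_dual x (M : R) :
  0 <= M -> (forall y, nrm (s x y) <= M * snrm s y) -> snrm s x <= M.
Proof.
move=> M0 /(_ x); rewrite snrmE nrm_real ?sqr_ge0// expr2.
have [->//|x0] := eqVneq (snrm s x) 0.
by rewrite ler_pM2r// lt_neqAle eq_sym x0 snrm_ge0.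
Qed.

End SemiInnerProduct.

(** * Convergence at an explicit rate *)

Section InverseSuccessor.
Variable R : realType.
Local Notation C := R[i].
(** A common rate for all approximations: equalities between limits are proved by bounding a
    difference by K / (n + 1) for every n, see [nrm_inv_succ]. *)
Definition inv_succ (n : nat) : R := n.+1%:R^-1.
Local Notation eps := inv_succ.

Lemma inv_succ_gt0 n : 0 < eps n :> R. Proof. by rewrite invr_gt0. Qed.

Lemma inv_succ_ge0 n : 0 <= eps n :> R. Proof. exact/ltW/inv_succ_gt0. Qed.

Lemma inv_succ_le1 n : eps n <= 1 :> R.
Proof. by rewrite /inv_succ invf_le1 // ler1n. Qed.

Lemma inv_succ_small (K e : R) : 0 < e ->
  exists N, forall n, (N <= n)%N -> K * eps n < e.
Proof.
move=> e0; exists (Num.trunc (`|K| / e)) => n Nn.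
rewrite ltr_pdivrMr//; apply: le_lt_trans (ler_norm K) _.
rewrite -ltr_pdivrMl// mulrC; apply: lt_le_trans (truncnS_gt _) _.
by rewrite ler_nat.
Qed.

Lemma nrm_inv_succ (V : normedZmodType C) (v : V) (K : R) :
  (forall n, nrm v <= K * eps n) -> v = 0.
Proof.
move=> h; apply: nrm_small => e e0; have [N HN] := inv_succ_small K e0.
exact: le_trans (h N) (ltW (HN _ (leqnn _))).
Qed.

Lemma real_seq_complete (u : nat -> R) (K : R) :
  (forall m n, `|u m - u n| <= K * (eps m + eps n)) ->
  exists l, forall n, `|u n - l| <= K * eps n.
Proof.
move=> uK.
have K0 : 0 <= K.
  have := le_trans (normr_ge0 _) (uK 0%N 0%N).
  by rewrite pmulr_lge0// addr_gt0 ?inv_succ_gt0.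
have : cauchy (u @ \oo).
  apply/cauchy_exP => e e0; have [N HN] := inv_succ_small (K *+ 2) e0.
  exists (u N); exists N => // n /= Nn; rewrite /ball/=.
  apply: le_lt_trans (uK _ _) _; apply: le_lt_trans (HN N (leqnn N)).
  rewrite mulr2n mulrDl -mulrDr ler_wpM2l// lerD2l lef_pV2 ?posrE// ler_nat//.
move/cauchy_cvg => /cvgrPdist_lt cu; exists (lim (u @ \oo)) => n.
apply/ler_addgt0Pr => e e0; have e20 : 0 < e / 2 by rewrite divr_gt0.
have [N1 _ HN1] := cu _ e20; have [N2 HN2] := inv_succ_small K e20.
set m := maxn N1 N2; have /= h1 := HN1 m (leq_maxl _ _).
have h2 := HN2 m (leq_maxr _ _); have h3 := uK n m.
have := ler_distD (u m) (u n) (lim (u @ \oo)).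
rewrite (distrC (u m)); lra.
Qed.

Lemma complex_seq_complete (z : nat -> C) (K : R) :
  (forall m n, nrm (z m - z n) <= K * (eps m + eps n)) ->
  exists l, forall n, nrm (z n - l) <= 2 * K * eps n.
Proof.
move=> zK.
have [m n|a Ha] := @real_seq_complete (fun n => complex.Re (z n)) K.
  by rewrite -raddfB; apply: le_trans (Re_nrm _) (zK m n).
have [m n|b Hb] := @real_seq_complete (fun n => complex.Im (z n)) K.
  by rewrite -raddfB; apply: le_trans (Im_nrm _) (zK m n).
exists (a +i* b) => n; apply: le_trans (nrm_le_ReIm _) _.
have := Ha n; have := Hb n; rewrite !raddfB/=; lra.
Qed.

Lemma nrm_seq_complete (V : completeNormedModType C) (u : nat -> V) (K : R) :
  0 <= K -> (forall m n, (n <= m)%N -> nrm (u m - u n) <= K * eps n) ->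
  exists l, forall n, nrm (u n - l) <= 2 * K * eps n.
Proof.
move=> K0 uC; have Ke n : 0 <= K * eps n by rewrite mulr_ge0// inv_succ_ge0.
have uC' m n : nrm (u m - u n) <= K * eps m + K * eps n.
  have [mn|/ltnW mn] := leqP m n.
    by rewrite nrmB; apply: le_trans (uC _ _ mn) _; rewrite lerDl.
  by apply: le_trans (uC _ _ mn) _; rewrite lerDr.
have [e e0|l Hl] := @nrm_complete R V u.
  have e20 : 0 < e / 2 by rewrite divr_gt0.
  have [N HN] := inv_succ_small K e20; exists N => m n Nm Nn.
  have := uC' m n; have := HN m Nm; have := HN n Nn; lra.
exists l => n; apply/ler_addgt0Pr => e e0; have e20 : 0 < e / 2 by rewrite divr_gt0.
have [N1 HN1] := Hl _ e20; have [N2 HN2] := inv_succ_small K e20.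
pose m := maxn N1 N2; have := HN1 m (leq_maxl _ _); have := HN2 m (leq_maxr _ _).
have := nrm_dist (u m) (u n) l; have := uC' n m; have := Ke n; lra.
Qed.

Lemma half_pow_le n : (2^-1) ^+ n <= eps n.
Proof.
rewrite exprVn lef_pV2 ?posrE ?exprn_gt0// -natrX ler_nat.
exact: ltn_expl.
Qed.

(** For n q < 1 this bounds (1 + q)^n by 1 / (1 - n q), in place of an estimate of the exponential.
    In the induction the left side decreases by (n + 1) q^2 (1 + q)^n. *)
Lemma bernoulli_inv (q : R) (n : nat) : 0 <= q -> (1 + q) ^+ n * (1 - n%:R * q) <= 1.
Proof.
move=> q0; elim: n => [|n IH]; first by rewrite expr0 mul0r subr0 mul1r.
have p0 : 0 <= (1 + q) ^+ n by rewrite exprn_ge0// addr_ge0.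
have n0 : 0 <= n%:R :> R by [].
have := mulr_ge0 p0 (mulr_ge0 (mulr_ge0 q0 q0) (addr_ge0 n0 ler01)).
rewrite exprS -natr1; lra.
Qed.

(** Uses 1 + N as an upper bound of the square root of N, to keep the later constants free of
    roots. *)
Lemma sqr_le_bound (t q N : R) : 0 <= N -> 0 <= q -> 0 <= t ->
  t ^+ 2 <= N * q ^+ 2 -> t <= (1 + N) * q.
Proof.
move=> N0 q0 t0 h; rewrite -ler_sqr ?nnegrE ?mulr_ge0 ?addr_ge0//.
apply: le_trans h _; rewrite exprMn ler_wpM2r ?sqr_ge0//; nra.
Qed.

End InverseSuccessor.

Section Completion.
Variables (R : realType) (E : lmodType R[i]) (s : E -> E -> R[i]).
Local Notation C := R[i].
Local Notation eps := (inv_succ R).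

Definition approx (f : E -> C) (u : E) (e : R) :=
  forall x, nrm (f x - s u x) <= e * snrm s x.

(** The functionals that are limits of [s u] in the dual norm. Vectors of seminorm zero all induce
    the zero functional, by Cauchy-Schwarz, so separation is automatic and no quotient is formed. *)
Record approximable := Approximable {
  approximable_fun :> E -> C ;
  approximableP : forall e, 0 < e -> exists u, approx approximable_fun u e
}.

(* The completion of (E, s), a vector being represented by its inner products
   with the elements of E. *)
Definition completion (hs : semi_ip s) : Type := approximable.

Lemma approximable_eq (f g : approximable) : (forall x, f x = g x) -> f = g.
Proof.
case: f g => [f Hf] [g Hg] /= /funext fg; move: Hf Hg; rewrite fg => Hf Hg.
by congr Approximable; exact: Prop_irrelevance.
Qed.

Hypothesis hs : semi_ip s.
Implicit Types f g : completion hs.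

Lemma approx_ip u e : 0 <= e -> approx (s u) u e.
Proof. by move=> e0 x; rewrite subrr nrm0 mulr_ge0// snrm_ge0. Qed.

Definition completion_in u : completion hs :=
  @Approximable (s u) (fun e e0 => ex_intro _ u (@approx_ip u e (ltW e0))).

Lemma approxD f g u v d e : approx f u d -> approx g v e ->
  approx (fun x => f x + g x) (u + v) (d + e).
Proof.
move=> fu gv x; rewrite (sipDl hs) opprD addrACA mulrDl.
exact: le_trans (nrmD_le _ _) (lerD (fu x) (gv x)).
Qed.

Lemma approxZ (f : E -> C) c u e : approx f u e ->
  approx (fun x => c * f x) (c *: u) (nrm c * e).
Proof. by move=> fu x; rewrite (sipZl hs) -mulrBr nrmM -mulrA ler_wpM2l ?nrm_ge0. Qed.

Lemma completion_add_subproof f g e : 0 < e ->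
  exists u, approx (fun x => f x + g x) u e.
Proof.
move=> e0; have e20 : 0 < e / 2 by rewrite divr_gt0.
have [u fu] := approximableP f e20; have [v gv] := approximableP g e20.
by exists (u + v); rewrite (splitr e); apply: approxD.
Qed.

Lemma completion_scale_subproof c f e : 0 < e ->
  exists u, approx (fun x => c * f x) u e.
Proof.
move=> e0; have c0 : 0 < nrm c + 1 by rewrite ltr_wpDl ?nrm_ge0.
have [u fu] := approximableP f (divr_gt0 e0 c0).
exists (c *: u) => x; apply: le_trans (approxZ c fu x) _.
rewrite ler_wpM2r ?snrm_ge0// mulrCA ler_piMr// ?ltW//.
by rewrite ltr_pdivrMr// mul1r ltrDl.
Qed.

Lemma completion_opp_subproof f e : 0 < e ->
  exists u, approx (fun x => - f x) u e.
Proof.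
move=> e0; have [u fu] := approximableP f e0.
by exists (- u) => x; rewrite (sipNl hs) -opprD nrmN.
Qed.

Definition completion_add f g : completion hs :=
  Approximable (@completion_add_subproof f g).
Definition completion_opp f : completion hs :=
  Approximable (@completion_opp_subproof f).
Definition completion_scale c f : completion hs :=
  Approximable (@completion_scale_subproof c f).

HB.instance Definition _ := gen_eqMixin (completion hs).
HB.instance Definition _ := gen_choiceMixin (completion hs).

Fact completion_addA : associative completion_add.
Proof. by move=> f g h; apply: approximable_eq => x /=; rewrite addrA. Qed.
Fact completion_addC : commutative completion_add.
Proof. by move=> f g; apply: approximable_eq => x /=; rewrite addrC. Qed.
Fact completion_add0 : left_id (completion_in 0) completion_add.
Proof. by move=> f; apply: approximable_eq => x /=; rewrite (sip0l hs) add0r. Qed.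
Fact completion_addN : left_inverse (completion_in 0) completion_opp completion_add.
Proof. by move=> f; apply: approximable_eq => x /=; rewrite (sip0l hs) addNr. Qed.

HB.instance Definition _ := GRing.isZmodule.Build (completion hs)
  completion_addA completion_addC completion_add0 completion_addN.

Fact completion_scaleA a b f :
  completion_scale a (completion_scale b f) = completion_scale (a * b) f.
Proof. by apply: approximable_eq => x /=; rewrite mulrA. Qed.
Fact completion_scale1 : left_id 1 completion_scale.
Proof. by move=> f; apply: approximable_eq => x /=; rewrite mul1r. Qed.
Fact completion_scaleDr : right_distributive completion_scale +%R.
Proof. by move=> a f g; apply: approximable_eq => x /=; rewrite mulrDr. Qed.
Fact completion_scaleDl f : {morph completion_scale^~ f : a b / a + b}.
Proof. by move=> a b; apply: approximable_eq => x /=; rewrite mulrDl. Qed.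

HB.instance Definition _ := GRing.Zmodule_isLmodule.Build C (completion hs)
  completion_scaleA completion_scale1 completion_scaleDr completion_scaleDl.

Lemma completionDE f g x : (f + g) x = f x + g x. Proof. by []. Qed.
Lemma completionZE c f x : (c *: f) x = c * f x. Proof. by []. Qed.
Lemma completionBE f g x : (f - g) x = f x - g x. Proof. by []. Qed.

Fact completion_in_linear : linear completion_in.
Proof. by move=> c u v; apply: approximable_eq => x /=; rewrite (sip_linear hs). Qed.
HB.instance Definition _ := GRing.isLinear.Build C E (completion hs) _
  completion_in completion_in_linear.

Definition approximant f (n : nat) : E :=
  projT1 (cid (approximableP f (inv_succ_gt0 R n))).

Lemma approximantP f n : approx f (approximant f n) (eps n).
Proof. exact: projT2 (cid (approximableP f (inv_succ_gt0 R n))). Qed.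

Lemma approx_dist f u v d e : 0 <= d -> 0 <= e -> approx f u d -> approx f v e ->
  snrm s (u - v) <= d + e.
Proof.
move=> d0 e0 fu fv; apply: (snrm_dual hs); rewrite ?addr_ge0// => x.
rewrite (sipBl hs) mulrDl; apply: le_trans (nrm_dist (f x) _ _) _.
by rewrite nrmB; apply: lerD.
Qed.

Lemma completion_bound f : exists M, 0 <= M /\
  (forall x, nrm (f x) <= M * snrm s x) /\
  forall u n, approx f u (eps n) -> snrm s u <= M.
Proof.
(* Two approximants of f, of indices n and 0, differ by at most [eps n + eps 0], which is at most
   2. *)
exists (snrm s (approximant f 0) + 2); split; first by rewrite addr_ge0 ?snrm_ge0.
have e1 n := inv_succ_le1 R n; have e0 n := inv_succ_ge0 R n.
split=> [x|u n fu].
  rewrite -[f x](subrK (s (approximant f 0) x)); apply: le_trans (nrmD_le _ _) _.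
  have h1 := approximantP f 0 x; have h2 := cauchy_schwarz hs (approximant f 0) x.
  have := e1 0%N; have := snrm_ge0 s x; nra.
rewrite -[u](subrK (approximant f 0)); apply: le_trans (snrmD_le hs _ _) _.
have := approx_dist (e0 n) (e0 0%N) fu (approximantP f 0).
have := e1 0%N; have := e1 n; lra.
Qed.

Lemma completionB f x y : f (x - y) = f x - f y.
Proof.
apply/eqP; rewrite -subr_eq0; apply/eqP.
apply: (@nrm_inv_succ _ _ _ (snrm s (x - y) + snrm s x + snrm s y)) => n.
have h1 := approximantP f n (x - y); have h2 := approximantP f n x.
have h3 := approximantP f n y; set u := approximant f n in h1 h2 h3.
have -> : f (x - y) - (f x - f y) =
    (f (x - y) - s u (x - y)) - (f x - s u x) + (f y - s u y).
  by rewrite (sipBr hs); ring.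
apply: le_trans (nrmD_le _ _) _.
rewrite !mulrDl; apply: lerD; last by rewrite mulrC.
by apply: le_trans (nrmB_le _ _) _; apply: lerD; rewrite mulrC.
Qed.

(** If v_n approximates g, then f(v_n) is the inner product of f with the image of v_n; it is a
    Cauchy sequence because f is additive and bounded. *)
Lemma completion_dot_subproof f g : exists z,
  exists K, forall n, nrm (f (approximant g n) - z) <= K * eps n.
Proof.
have [M [M0 [Mf _]]] := completion_bound f.
have [m n|z Hz] := @complex_seq_complete R (fun n => f (approximant g n)) M.
  rewrite -completionB; apply: le_trans (Mf _) _; rewrite ler_wpM2l//.
  by apply: (@approx_dist g); rewrite ?inv_succ_ge0//; apply: approximantP.
by exists z, (2 * M).
Qed.

Definition completion_dot f g : C := projT1 (cid (completion_dot_subproof f g)).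

Lemma completion_dotP f g :
  exists K, forall n, nrm (f (approximant g n) - completion_dot f g) <= K * eps n.
Proof. exact: projT2 (cid (completion_dot_subproof f g)). Qed.

Lemma completion_dot_approx f g : exists K, forall n,
  nrm (s (approximant f n) (approximant g n) - completion_dot f g) <= K * eps n.
Proof.
have [K HK] := completion_dotP f g; have [M [M0 [_ Mg]]] := completion_bound g.
exists (K + M) => n; apply: le_trans (nrm_dist (f (approximant g n)) _ _) _.
rewrite nrmB mulrDl addrC lerD//; apply: le_trans (approximantP _ _ _) _.
rewrite [leLHS]mulrC ler_wpM2r ?inv_succ_ge0//.
by apply: (Mg _ n); apply: approximantP.
Qed.

Lemma completion_dot_linear c f g h :
  completion_dot (c *: f + g) h = c * completion_dot f h + completion_dot g h.
Proof.
have [K1 H1] := completion_dotP (c *: f + g) h.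
have [K2 H2] := completion_dotP f h; have [K3 H3] := completion_dotP g h.
apply/eqP; rewrite -subr_eq0; apply/eqP.
apply: (@nrm_inv_succ _ _ _ (K1 + nrm c * K2 + K3)) => n; set u := approximant h n.
have -> : completion_dot (c *: f + g) h -
    (c * completion_dot f h + completion_dot g h) =
  (c * (f u - completion_dot f h) + (g u - completion_dot g h))
  - ((c *: f + g) u - completion_dot (c *: f + g) h).
  by rewrite completionDE completionZE; ring.
apply: le_trans (nrmB_le _ _) _.
have := nrmD_le (c * (f u - completion_dot f h)) (g u - completion_dot g h).
have := H1 n; have := H3 n; have := ler_wpM2l (nrm_ge0 c) (H2 n).
rewrite nrmM -/u; lra.
Qed.

Lemma completion_dotC f g : completion_dot g f = (completion_dot f g)^*%C.
Proof.
have [K1 H1] := completion_dot_approx f g.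
have [K2 H2] := completion_dot_approx g f.
apply/eqP; rewrite -subr_eq0; apply/eqP.
apply: (@nrm_inv_succ _ _ _ (K1 + K2)) => n.
set u := approximant f n; set v := approximant g n.
apply: le_trans (nrm_dist (s v u) _ _) _; rewrite [leLHS]addrC mulrDl lerD//.
  by rewrite (sipC hs u v) -nrm_conj conjcD conjcN !conjcK; apply: H1.
by rewrite nrmB; apply: H2.
Qed.

Lemma completion_dot_ge0 f : 0 <= completion_dot f f.
Proof.
have [K HK] := completion_dot_approx f f.
(* Nonnegativity in R[i] is turned into an equation, which passes to the limit like the others. *)
suff <- : `|completion_dot f f| = completion_dot f f by [].
apply/eqP; rewrite -subr_eq0; apply/eqP.
apply: (@nrm_inv_succ _ _ _ (K * 2)) => n; set u := approximant f n.
have h1 : nrm (`|completion_dot f f| - s u u) <= nrm (s u u - completion_dot f f).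
  rewrite -[X in _ - X]ger0_norm ?(sip_ge0 hs)// [leRHS]nrmB -lecR -!nrmE.
  exact: ler_dist_dist.
apply: le_trans (nrm_dist (s u u) _ _) _; have := HK n; rewrite -/u; lra.
Qed.

Lemma completion_semi_ip : semi_ip completion_dot.
Proof.
by split; [exact: completion_dot_linear|exact: completion_dotC|exact: completion_dot_ge0].
Qed.

Lemma completion_dot_in f x : completion_dot f (completion_in x) = f x.
Proof.
have [K HK] := completion_dotP f (completion_in x).
have [M [M0 [Mf _]]] := completion_bound f.
apply/eqP; rewrite -subr_eq0; apply/eqP.
apply: (@nrm_inv_succ _ _ _ (K + M)) => n.
apply: le_trans (nrm_dist (f (approximant (completion_in x) n)) _ _) _.
rewrite nrmB mulrDl lerD// -completionB; apply: le_trans (Mf _) _.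
rewrite ler_wpM2l// -[leRHS]addr0; apply: (@approx_dist (completion_in x)) => //.
- exact: inv_succ_ge0.
- exact: approximantP.
- exact: approx_ip.
Qed.

Lemma completion_dot_eq0 f : snrm completion_dot f = 0 -> f = 0.
Proof.
move=> f0; apply: approximable_eq => x; rewrite [RHS](sip0l hs).
rewrite -completion_dot_in; apply: nrm_small => e e0.
apply: le_trans (cauchy_schwarz completion_semi_ip _ _) _.
by rewrite f0 mul0r ltW.
Qed.

Definition completion_norm f : C := (snrm completion_dot f)%:C.

Fact completion_normD f g :
  completion_norm (f + g) <= completion_norm f + completion_norm g.
Proof. by rewrite -rmorphD lecR (snrmD_le completion_semi_ip). Qed.

Fact completion_normZ c f : completion_norm (c *: f) = `|c| * completion_norm f.
Proof. by rewrite nrmE -rmorphM/= -(snrmZ completion_semi_ip). Qed.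

Fact completion_norm_eq0 f : completion_norm f = 0 -> f = 0.
Proof. by move=> /complexI/completion_dot_eq0. Qed.

HB.instance Definition _ := Lmodule_isNormed.Build C (completion hs)
  completion_normD completion_normZ completion_norm_eq0.

Lemma completion_nrm f : nrm f = snrm completion_dot f.
Proof. by []. Qed.

Lemma completion_in_nrm x : nrm (completion_in x) = snrm s x.
Proof. by rewrite completion_nrm /snrm completion_dot_in. Qed.

(** The squared distance is <f, f> - f(u) - conj(f(u)) + s(u, u), and along the approximants u of f
    the last three quantities all tend to <f, f>. *)
Lemma completion_dense f (e : R) : 0 < e -> exists u, nrm (f - completion_in u) <= e.
Proof.
move=> e0; have [K1 H1] := completion_dotP f f.
have [K2 H2] := completion_dot_approx f f.
have [n HN] := inv_succ_small (K1 + K1 + K2) (exprn_gt0 2 e0).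
have Hn := HN n (leqnn n); set u := approximant f n; exists u.
rewrite completion_nrm -ler_sqr ?nnegrE ?snrm_ge0 ?(ltW e0)// -[leLHS]nrm_real ?sqr_ge0//.
rewrite -(snrmE completion_semi_ip); apply: le_trans (ltW Hn).
rewrite (sipBl completion_semi_ip) !(sipBr completion_semi_ip) completion_dot_in.
rewrite [completion_dot (completion_in u) f](sipC completion_semi_ip) !completion_dot_in /=.
set d := completion_dot f f.
have dE : d = (d^*)%C by rewrite -(sipC completion_semi_ip).
have -> : d - f u - ((f u)^*%C - s u u) = (s u u - d) - (f u - d) - ((f u - d)^*)%C.
  by rewrite conjcD conjcN -dE; ring.
apply: le_trans (nrmB_le _ _) _; rewrite nrm_conj.
have := H1 n; have := H2 n; rewrite -/u -/d => h2 h1.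
have := nrmB_le (s u u - d) (f u - d); lra.
Qed.

End Completion.

(** * The completion as a Hilbert space *)

Section CompletionHilbert.
Variables (R : realType) (E : lmodType R[i]) (s : E -> E -> R[i]).
Hypothesis hs : semi_ip s.
Local Notation C := R[i].
Local Notation eps := (inv_succ R).
Implicit Types f g : completion hs.

(** Write <f, f> = <f, f - j u> + f(u) with j u close to f: the second term is at most M times the
    norm of u, and the first one is small. *)
Lemma completion_norm_le f (M : R) :
  0 <= M -> (forall x, nrm (f x) <= M * snrm s x) -> nrm f <= M.
Proof.
move=> M0 Mf; have [->|fn0] := eqVneq f 0; first by rewrite nrm0.
rewrite -(ler_pM2r (nrm_gt0 fn0)) -expr2; apply/ler_addgt0Pr => e e0.
have D0 : 0 < M + nrm f by rewrite ltr_wpDl// nrm_gt0.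
have [u fu] := completion_dense f (divr_gt0 e0 D0).
set d := e / _ in fu; have dE : d * (M + nrm f) = e by rewrite divfK// gt_eqF.
have := snrmE (completion_semi_ip hs) f; rewrite -completion_nrm => h.
rewrite -[leLHS]nrm_real ?sqr_ge0// -h.
have -> : completion_dot f f = completion_dot f (f - completion_in hs u) + f u.
  by rewrite (sipBr (completion_semi_ip hs)) completion_dot_in subrK.
apply: le_trans (nrmD_le _ _) _.
have h1 := cauchy_schwarz (completion_semi_ip hs) f (f - completion_in hs u).
have h2 := Mf u; rewrite -2!completion_nrm in h1.
have h3 : snrm s u <= nrm f + d.
  rewrite -(completion_in_nrm hs) -[completion_in hs u](subKr f).
  by apply: le_trans (nrmB_le _ _) _; rewrite lerD2l.
have := nrm_ge0 f; nra.
Qed.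

(** Vectors [u n] of E follow the filter at rate [eps n]. The functionals [s (u n)] converge
    pointwise, with an error proportional to [snrm s x], and this proportionality makes the limit
    approximable. *)
Lemma completion_complete (F : set_system (completion hs)) :
  ProperFilter F -> cauchy F -> cvg F.
Proof.
move=> FF /cauchyP cF.
have H n : exists u, F [set g | nrm (completion_in hs u - g) < 2 * eps n].
  have e0 := inv_succ_gt0 R n.
  have [|f Ff] := cF (eps n)%:C; first by rewrite ltcR.
  have [u fu] := completion_dense f e0; exists u.
  apply: filterS Ff => g /ball_nrm fg /=.
  apply: le_lt_trans (nrm_dist f _ _) _; rewrite nrmB; lra.
pose u n := projT1 (cid (H n)).
have Fu n : F [set g | nrm (completion_in hs (u n) - g) < 2 * eps n].
  exact: projT2 (cid (H n)).
have uC m n : snrm s (u m - u n) <= 2 * (eps m + eps n).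
  rewrite -(completion_in_nrm hs) linearB/=.
  have [g [/= h1 h2]] := filter_ex (filterI (Fu m) (Fu n)).
  apply: le_trans (nrm_dist g _ _) _; rewrite [X in _ + X]nrmB; lra.
have L x : exists l, forall n, nrm (s (u n) x - l) <= 4 * snrm s x * eps n.
  have [m n|l Hl] := @complex_seq_complete R (fun n => s (u n) x) (2 * snrm s x).
    rewrite -(sipBl hs); apply: le_trans (cauchy_schwarz hs _ _) _.
    by rewrite [leRHS]mulrAC ler_wpM2r ?snrm_ge0 ?uC.
  exists l => n; have := Hl n; lra.
pose f0 x := projT1 (cid (L x)).
have fu n : approx s f0 (u n) (4 * eps n).
  by move=> x; rewrite nrmB mulrAC; apply: projT2 (cid (L x)) n.
have fP e : 0 < e -> exists u, approx s f0 u e.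
  move=> e0; have [n Hn] := inv_succ_small 4 e0; exists (u n) => x.
  by apply: le_trans (fu n x) _; rewrite ler_wpM2r ?snrm_ge0// ltW// Hn.
pose f : completion hs := Approximable fP.
apply/cvg_ex; exists f => P /nbhs_nrm[e e0 He].
have [n Hn] := inv_succ_small 6 e0; apply: filterS (Fu n) => g /= ug.
apply: He; apply: le_lt_trans (nrm_dist (completion_in hs (u n)) _ _) _.
have : nrm (f - completion_in hs (u n)) <= 4 * eps n.
  apply: completion_norm_le; first by rewrite mulr_ge0// inv_succ_ge0.
  by move=> x; rewrite completionBE; apply: fu.
have := Hn n (leqnn n); lra.
Qed.

HB.instance Definition _ :=
  Uniform_isComplete.Build (completion hs) completion_complete.

Let dot := @completion_dot R E s hs.

Fact completion_dot_addl g : zmod_morphism (dot ^~ g).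
Proof. by move=> f h; rewrite /dot (sipBl (completion_semi_ip hs)). Qed.
Fact completion_dot_addr f : zmod_morphism (dot f).
Proof. by move=> g h; rewrite /dot (sipBr (completion_semi_ip hs)). Qed.
Fact completion_dot_scalel g : scalable_for *%R (dot ^~ g).
Proof. by move=> c f; rewrite /dot (sipZl (completion_semi_ip hs)). Qed.
Fact completion_dot_scaler f : scalable_for (conjC \; *%R) (dot f).
Proof. by move=> c g; rewrite /dot (sipZr (completion_semi_ip hs)). Qed.
HB.instance Definition _ := isBilinear.Build C (completion hs) (completion hs) C
  ( *%R ) (conjC \; *%R) (@completion_dot R E s hs)
  completion_dot_addl completion_dot_addr completion_dot_scalel completion_dot_scaler.

Fact completion_dot_herm f g : dot f g = (-1) ^+ false * conjC (dot g f).
Proof. by rewrite expr0 mul1r; exact: sipC (completion_semi_ip hs) _ _. Qed.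
HB.instance Definition _ := isHermitianSesquilinear.Build C (completion hs) false
  conjC (@completion_dot R E s hs) completion_dot_herm.

Fact completion_dot_gt0 f : f != 0 -> 0 < dot f f.
Proof.
move=> f0; rewrite /dot (snrmE (completion_semi_ip hs)) -completion_nrm ltcR.
by rewrite exprn_gt0// nrm_gt0.
Qed.
HB.instance Definition _ := isDotProduct.Build C (completion hs)
  (@completion_dot R E s hs) completion_dot_gt0.

Fact completion_hdot_norm f : `|f| ^+ 2 = dot f f.
Proof. by rewrite /dot (snrmE (completion_semi_ip hs)) -completion_nrm nrmE rmorphXn. Qed.

Definition hilbert_completion : hilbertSpace R :=
  @HilbertSpace R (completion hs) (@completion_dot R E s hs) completion_hdot_norm.

End CompletionHilbert.

(** * Bounded operators *)

Section BoundedOperators.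
Variable R : realType.
Local Notation C := R[i].
Local Notation eps := (inv_succ R).

Definition bounded_linear (V W : normedModType C) (T : V -> W) :=
  linear T /\ exists M : R, 0 <= M /\ forall v, nrm (T v) <= M * nrm v.

Definition lipschitz_map (V W : normedZmodType C) (f : V -> W) :=
  exists M : R, 0 <= M /\ forall x y, nrm (f x - f y) <= M * nrm (x - y).

Definition dense_map (E : Type) (V : normedZmodType C) (j : E -> V) :=
  forall v (e : R), 0 < e -> exists u, nrm (v - j u) <= e.

Lemma linear_fun0 (V W : lmodType C) (T : V -> W) : linear T -> T 0 = 0.
Proof. by move=> h; have := h (-1) 0 0; rewrite scaler0 addr0 scaleN1r addNr. Qed.

Lemma linear_funD (V W : lmodType C) (T : V -> W) x y :
  linear T -> T (x + y) = T x + T y.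
Proof. by move=> h; have := h 1 x y; rewrite !scale1r. Qed.

Lemma linear_funZ (V W : lmodType C) (T : V -> W) c x :
  linear T -> T (c *: x) = c *: T x.
Proof. by move=> h; have := h c x 0; rewrite (linear_fun0 h) !addr0. Qed.

Lemma linear_funB (V W : lmodType C) (T : V -> W) x y :
  linear T -> T (x - y) = T x - T y.
Proof. by move=> h; rewrite (linear_funD _ _ h) -scaleN1r (linear_funZ _ _ h) scaleN1r. Qed.

Lemma bounded_linear_lipschitz (V W : normedModType C) (T : V -> W) :
  bounded_linear T -> lipschitz_map T.
Proof.
by move=> [lT [M [M0 HM]]]; exists M; split=> // x y; rewrite -linear_funB.
Qed.

Lemma lipschitz_comp (V W U : normedZmodType C) (f : W -> U) (g : V -> W) :
  lipschitz_map f -> lipschitz_map g -> lipschitz_map (f \o g).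
Proof.
move=> [M [M0 HM]] [N [N0 HN]]; exists (M * N); split; first exact: mulr_ge0.
move=> x y /=; apply: le_trans (HM _ _) _; rewrite -mulrA.
by rewrite ler_wpM2l.
Qed.

(** Reduces an identity between operators to vectors [j x] of K or [pi b xi] of H, where it becomes
    bimodule algebra. *)
Lemma lipschitz_dense_eq (E : Type) (V W : normedZmodType C) (j : E -> V)
    (f g : V -> W) : dense_map j -> lipschitz_map f -> lipschitz_map g ->
  (forall u, f (j u) = g (j u)) -> forall v, f v = g v.
Proof.
move=> jd [M [M0 HM]] [N [N0 HN]] fg v; apply/eqP; rewrite -subr_eq0; apply/eqP.
apply: (@nrm_inv_succ _ _ _ (M + N)) => n.
have [u vu] := jd v _ (inv_succ_gt0 R n).
apply: le_trans (nrm_dist (f (j u)) _ _) _; rewrite mulrDl lerD//.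
  by apply: le_trans (HM _ _) _; rewrite ler_wpM2l.
by rewrite fg; apply: le_trans (HN _ _) _; rewrite nrmB ler_wpM2l.
Qed.

Definition limit_closed (V : normedZmodType C) (S : set V) :=
  forall v, (forall e : R, 0 < e -> exists2 w, S w & nrm (v - w) < e) -> S v.

Lemma limit_closed_preimage (V W : normedZmodType C) (f : V -> W) (S : set W) :
  limit_closed S -> lipschitz_map f -> limit_closed [set v | S (f v)].
Proof.
move=> Scl [M [M0 HM]] v Hv; apply: Scl => e e0.
have D0 : 0 < M + 1 by rewrite ltr_wpDl.
have [w Sw vw] := Hv _ (divr_gt0 e0 D0); exists (f w) => //.
apply: le_lt_trans (HM _ _) _; set d := e / _ in vw.
have <- : d * (M + 1) = e by rewrite divfK// gt_eqF.
have d0 : 0 < d by rewrite divr_gt0.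
have := ler_wpM2l M0 (ltW vw); lra.
Qed.

Lemma limit_closed_forall (I : Type) (V : normedZmodType C) (S : I -> set V) :
  (forall i, limit_closed (S i)) -> limit_closed [set v | forall i, S i v].
Proof.
move=> Scl v Hv i; apply: Scl => e e0; have [w Sw vw] := Hv e e0.
by exists w => //; exact: Sw.
Qed.

Lemma limit_closed0 (V : normedZmodType C) : limit_closed [set v : V | v = 0].
Proof.
move=> v Hv; apply: nrm_small => e e0; have [_ -> ve] := Hv e e0.
by rewrite subr0 in ve; exact: ltW.
Qed.

(** The value l at v is pinned down by |l - t u| <= M |v - j u| for all u at once; linearity, the
    bound and the extension property follow from this inequality alone. The map j may have a kernel:
    the bound on t makes the extension well defined. *)
Lemma bounded_extension (E : lmodType C) (V : normedModType C)
    (W : completeNormedModType C) (j : E -> V) (t : E -> W) (M : R) :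
  linear j -> linear t -> dense_map j -> 0 <= M ->
  (forall u, nrm (t u) <= M * nrm (j u)) ->
  exists T : V -> W, linear T /\ (forall v, nrm (T v) <= M * nrm v) /\
    forall u, T (j u) = t u.
Proof.
move=> lj lt jd M0 tj.
have H v : exists l, forall u, nrm (l - t u) <= M * nrm (v - j u).
  pose u n := projT1 (cid (jd v _ (inv_succ_gt0 R n))).
  have vu n : nrm (v - j (u n)) <= eps n.
    exact: projT2 (cid (jd v _ (inv_succ_gt0 R n))).
  have tB a b : nrm (t a - t b) <= M * (nrm (v - j a) + nrm (v - j b)).
    rewrite -linear_funB//; apply: le_trans (tj _) _; rewrite ler_wpM2l//.
    rewrite linear_funB//; apply: le_trans (nrm_dist v _ _) _.
    by rewrite [X in X + _]nrmB.
  have [e e0|l Hl] := @nrm_complete R W (t \o u).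
    have [N HN] := inv_succ_small (2 * M) e0; exists N => m n Nm Nn /=.
    apply: le_lt_trans (tB _ _) _.
    have := HN m Nm; have := HN n Nn; have := ler_wpM2l M0 (vu m).
    have := ler_wpM2l M0 (vu n); lra.
  exists l => a; apply/ler_addgt0Pr => e e0; have e20 : 0 < e / 2 by rewrite divr_gt0.
  have [N1 HN1] := Hl _ e20; have [N2 HN2] := inv_succ_small M e20.
  pose n := maxn N1 N2.
  have := nrm_dist (t (u n)) l (t a); rewrite (nrmB l (t (u n))).
  have := HN1 n (leq_maxl _ _).
  have := HN2 n (leq_maxr _ _); have := tB (u n) a; rewrite /=.
  have := ler_wpM2l M0 (vu n); lra.
pose T v := projT1 (cid (H v)).
have HT v u : nrm (T v - t u) <= M * nrm (v - j u).
  by move: u; exact: projT2 (cid (H v)).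
exists T; split; [|split].
- move=> c v w; apply/eqP; rewrite -subr_eq0; apply/eqP.
  apply: (@nrm_inv_succ _ _ _ (2 * (nrm c * M + M))) => n.
  have [a Ha] := jd v _ (inv_succ_gt0 R n); have [b Hb] := jd w _ (inv_succ_gt0 R n).
  have h1 := le_trans (HT v a) (ler_wpM2l M0 Ha).
  have h2 := le_trans (HT w b) (ler_wpM2l M0 Hb).
  have h3 := HT (c *: v + w) (c *: a + b); rewrite lt in h3.
  have h4 : nrm (c *: v + w - j (c *: a + b)) <= (nrm c + 1) * eps n.
    rewrite lj opprD addrACA -scalerBr mulrDl mul1r.
    apply: le_trans (nrmD_le _ _) _; rewrite lerD// nrmZ ler_wpM2l ?nrm_ge0//.
  have h5 := ler_wpM2l M0 h4.
  have h6 : nrm (c *: T v + T w - (c *: t a + t b)) <= (nrm c * M + M) * eps n.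
    rewrite opprD addrACA -scalerBr mulrDl.
    apply: le_trans (nrmD_le _ _) _; rewrite lerD// nrmZ -mulrA ler_wpM2l ?nrm_ge0//.
  apply: le_trans (nrm_dist (c *: t a + t b) _ _) _.
  rewrite [X in _ + X]nrmB; lra.
- move=> v; apply/ler_addgt0Pr => e e0.
  have D0 : 0 < 2 * M + 1 by rewrite ltr_wpDl// mulr_ge0.
  have [u vu] := jd v _ (divr_gt0 e0 D0); set d := e / _ in vu.
  have dE : d * (2 * M + 1) = e by rewrite divfK// gt_eqF.
  have d0 : 0 < d by rewrite divr_gt0.
  have h1 := HT v u; have h2 := tj u.
  have h3 : nrm (j u) <= nrm v + d.
    by rewrite -[j u](subKr v); apply: le_trans (nrmB_le _ _) _; rewrite lerD2l.
  have h4 : nrm (T v) <= nrm (T v - t u) + nrm (t u).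
    by rewrite -{1}[T v](subrK (t u)) nrmD_le.
  have := ler_wpM2l M0 h3; have := ler_wpM2l M0 vu; lra.
- move=> u; apply/eqP; rewrite -subr_eq0; apply/eqP/nrm_eq0/eqP.
  rewrite eq_le nrm_ge0 andbT; apply: le_trans (HT _ _) _.
  by rewrite subrr nrm0 mulr0.
Qed.

End BoundedOperators.

Section Hilbert.
Variables (R : realType) (H : hilbertSpace R).
Local Notation C := R[i].
Implicit Types x y z : H.

Lemma hdot_semi_ip : semi_ip (@hdot R H).
Proof.
split=> [c x y z|x y|x].
- by rewrite linearPl.
- by have := hermitian_subproof (s := @hdot R H) y x; rewrite expr0 mul1r.
- by rewrite -hdot_norm exprn_ge0.
Qed.

Lemma hdot_nrm x : hdot x x = (nrm x ^+ 2)%:C.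
Proof. by rewrite -hdot_norm nrmE rmorphXn. Qed.

Lemma snrm_hdot x : snrm (@hdot R H) x = nrm x.
Proof. by rewrite /snrm hdot_nrm/= sqrtr_sqr ger0_norm ?nrm_ge0. Qed.

Lemma hdot_cauchy_schwarz x y : nrm (hdot x y) <= nrm x * nrm y.
Proof. by rewrite -!snrm_hdot; exact: cauchy_schwarz hdot_semi_ip x y. Qed.

Lemma hdot_eq0 x : hdot x x = 0 -> x = 0.
Proof.
by rewrite hdot_nrm => /complexI/eqP; rewrite sqrf_eq0 => /eqP/nrm_eq0.
Qed.

Lemma hdot_ext x y : (forall z, hdot x z = hdot y z) -> x = y.
Proof.
move=> h; apply/eqP; rewrite -subr_eq0; apply/eqP/hdot_eq0.
by rewrite (sipBl hdot_semi_ip) h subrr.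
Qed.

Lemma hdot_dual x (M : R) : 0 <= M -> (forall z, nrm (hdot x z) <= M * nrm z) ->
  nrm x <= M.
Proof.
move=> M0 h; rewrite -snrm_hdot; apply: (snrm_dual hdot_semi_ip) => // z.
by rewrite snrm_hdot.
Qed.

Lemma lipschitz_hdotl z : lipschitz_map (fun x => hdot x z : C).
Proof.
exists (nrm z); split; first exact: nrm_ge0.
by move=> x y; rewrite -(sipBl hdot_semi_ip) mulrC hdot_cauchy_schwarz.
Qed.

Lemma lipschitz_hdotr z : lipschitz_map (fun x => hdot z x : C).
Proof.
exists (nrm z); split; first exact: nrm_ge0.
by move=> x y; rewrite -(sipBr hdot_semi_ip) hdot_cauchy_schwarz.
Qed.

End Hilbert.

(** * Elementary C*-algebra estimates *)

Section CstarAlgebra.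
Variables (R : realType) (A : cstarAlgebra R).
Local Notation C := R[i].
Local Notation eps := (inv_succ R).
Local Notation "a ∗ b" := (cmul a b) (at level 40, left associativity).
Implicit Types a b h : A.

Lemma cstarZ c a : cstar (c *: a) = (c^*)%C *: cstar a.
Proof. exact: linearZ_LR. Qed.

Lemma cstarB a b : cstar (a - b) = cstar a - cstar b.
Proof. exact: linearB. Qed.

Lemma cstarD a b : cstar (a + b) = cstar a + cstar b.
Proof. exact: linearD. Qed.

Lemma cmulDl a b c : (a + b) ∗ c = a ∗ c + b ∗ c. Proof. exact: linearDl. Qed.
Lemma cmulDr a b c : c ∗ (a + b) = c ∗ a + c ∗ b. Proof. exact: linearDr. Qed.
Lemma cmulBl a b c : (a - b) ∗ c = a ∗ c - b ∗ c. Proof. exact: linearBl. Qed.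
Lemma cmulBr a b c : c ∗ (a - b) = c ∗ a - c ∗ b. Proof. exact: linearBr. Qed.
Lemma cmulZl z a b : (z *: a) ∗ b = z *: (a ∗ b). Proof. exact: linearZl_LR. Qed.
Lemma cmulZr z a b : a ∗ (z *: b) = z *: (a ∗ b). Proof. exact: linearZr_LR. Qed.
Lemma cmul0l a : 0 ∗ a = 0. Proof. exact: linear0l. Qed.

Lemma nrm_cmul a b : nrm (a ∗ b) <= nrm a * nrm b.
Proof. by rewrite -lecR rmorphM/= -!nrmE cnormM_le. Qed.

Lemma nrm_cstar_mul a : nrm (cstar a ∗ a) = nrm a ^+ 2.
Proof. by apply/complexI; rewrite rmorphXn/= -!nrmE cnorm_star_mul. Qed.

Lemma nrm_cstar a : nrm (cstar a) = nrm a.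
Proof.
have le b : nrm b <= nrm (cstar b).
  have [->|b0] := eqVneq b 0; first by rewrite nrm0 nrm_ge0.
  by rewrite -(ler_pM2r (nrm_gt0 b0)) -expr2 -nrm_cstar_mul nrm_cmul.
by apply/eqP; rewrite eq_le le -{2}[a](@cstarK _ A) le.
Qed.

Lemma nrm_selfadjoint_sqr h : cstar h = h -> nrm (h ∗ h) = nrm h ^+ 2.
Proof. by move=> hh; rewrite -{1}hh nrm_cstar_mul. Qed.

Lemma cmul_eq0_selfadjoint h : cstar h = h -> h ∗ h = 0 -> h = 0.
Proof.
move=> hh h0; apply/nrm_eq0/eqP; rewrite -sqrf_eq0 -nrm_selfadjoint_sqr//.
by rewrite h0 nrm0.
Qed.

(* The fixed point of the contraction y |-> (h + y^2) / 2 of the ball of radius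
   1/2; thus 1 - y is a square root of 1 - h. *)
Lemma cstar_sqrt h : cstar h = h -> nrm h <= 3 / 4 ->
  exists y, cstar y = y /\ h = y + y - y ∗ y.
Proof.
move=> hh h34; pose F y := (2^-1 : R)%:C *: (h + y ∗ y); pose u n := iter n F 0.
have half : nrm (2^-1 : R)%:C = 2^-1 by rewrite nrm_real.
(* The ball is stable because (3/4 + 1/4) / 2 = 1/2. *)
have u12 n : nrm (u n) <= 1 / 2.
  elim: n => [|n IH] /=; first by rewrite nrm0 divr_ge0.
  rewrite {1}/F nrmZ half; have := nrmD_le h (u n ∗ u n).
  have := nrm_cmul (u n) (u n); have := nrm_ge0 (u n); nra.
have uS n : cstar (u n) = u n.
  elim: n => [|n IH] /=; first by rewrite linear0.
  by rewrite {1}/F cstarZ cstarD cstarM IH hh conjc_real.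
have uC n k : nrm (u (n + k)%N - u n) <= (2^-1) ^+ n.
  elim: n => [|n IH]; first by rewrite subr0 expr0; have := u12 k; lra.
  rewrite addSn /= /F -scalerBr opprD addrACA subrr add0r nrmZ half exprS.
  rewrite ler_pM2l// -/(u n) -/(u (n + k)%N).
  set a := u (n + k)%N; set b := u n.
  have -> : a ∗ a - b ∗ b = a ∗ (a - b) + (a - b) ∗ b.
    by rewrite cmulBr cmulBl addrA subrK.
  apply: le_trans (nrmD_le _ _) _.
  have := nrm_cmul a (a - b); have := nrm_cmul (a - b) b.
  have := u12 n; have := u12 (n + k)%N; rewrite -/a -/b.
  have := IH; rewrite -/a -/b; have := nrm_ge0 (a - b); nra.
have [|m n nm|y Hy] := @nrm_seq_complete R A u 1; first exact: ler01.
  by rewrite mul1r -(subnKC nm); apply: le_trans (uC _ _) (half_pow_le R n).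
have {}Hy n : nrm (u n - y) <= 2 * eps n by have := Hy n; rewrite mulr1.
exists y; split.
  apply/eqP; rewrite -subr_eq0; apply/eqP.
  apply: (@nrm_inv_succ _ _ _ 4) => n.
  apply: le_trans (nrm_dist (u n) _ _) _.
  have -> : nrm (cstar y - u n) = nrm (u n - y).
    by rewrite -[in LHS](uS n) -linearB nrm_cstar nrmB.
  have := Hy n; lra.
apply/eqP; rewrite -subr_eq0; apply/eqP.
have y1 : nrm y <= 5 / 2.
  rewrite -[y](subKr (u 0%N)); apply: le_trans (nrmB_le _ _) _.
  have := Hy 0%N; have := u12 0%N; have := inv_succ_le1 R 0; lra.
(* In units of [eps n]: 2 + 2 for the two copies of [u n.+1 - y], 1 for [u n] times the error, 5 for
   the error times y. *)
apply: (@nrm_inv_succ _ _ _ 10) => n.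
have e1 : u n.+1 + u n.+1 = h + u n ∗ u n.
  rewrite /u /= {1 2}/F -scalerDl -rmorphD/= -[X in _ + X]mul1r -[X in X + _]mul1r.
  by rewrite -mulrDl divff// scale1r.
have e2 : u n ∗ u n - y ∗ y = u n ∗ (u n - y) + (u n - y) ∗ y.
  by rewrite cmulBr cmulBl addrA subrK.
have -> : h - (y + y - y ∗ y) =
    (u n.+1 - y) + (u n.+1 - y) - (u n ∗ (u n - y) + (u n - y) ∗ y).
  rewrite -e2 addrACA e1 -opprD !opprB (addrAC h) (addrC _ (- (u n ∗ u n))).
  by rewrite [RHS]addrA addrK addrA addrAC.
apply: le_trans (nrmB_le _ _) _.
have := nrmD_le (u n.+1 - y) (u n.+1 - y).
have := nrmD_le (u n ∗ (u n - y)) ((u n - y) ∗ y).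
have := nrm_cmul (u n) (u n - y); have := nrm_cmul (u n - y) y.
have h1 := Hy n; have := Hy n.+1; have h2 := u12 n; have h0 := nrm_ge0 (u n - y).
have : inv_succ R n.+1 <= eps n by rewrite lef_pV2 ?posrE// ler_nat.
have : nrm (u n - y) * nrm y <= (2 * eps n) * (5 / 2).
  by apply: ler_pM; rewrite ?nrm_ge0.
have : nrm (u n) * nrm (u n - y) <= (1 / 2) * (2 * eps n).
  by apply: ler_pM; rewrite ?nrm_ge0.
lra.
Qed.

End CstarAlgebra.

(** * Boundedness of star actions on semi-inner product spaces *)

Section StarAction.
Variables (R : realType) (A : cstarAlgebra R) (E : lmodType R[i]).
Local Notation C := R[i].
Local Notation "a ∗ b" := (cmul a b) (at level 40, left associativity).

(** Covers both a representation on H and the action on X with the induced form, which is only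
    semidefinite. *)
Record is_star_action (s : E -> E -> C) (m : A -> E -> E) : Prop := {
  saP : forall c a b x, m (c *: a + b) x = c *: m a x + m b x ;
  sa_mul : forall a b x, m (a ∗ b) x = m a (m b x) ;
  sa_star : forall a x y, s (m a x) y = s x (m (cstar a) y)
}.

Variables (s : E -> E -> C) (m : A -> E -> E).
Hypotheses (hs : semi_ip s) (hm : is_star_action s m).

Lemma star_actionD a b x : m (a + b) x = m a x + m b x.
Proof. by have := saP hm 1 a b x; rewrite !scale1r. Qed.

Lemma star_action0 x : m 0 x = 0.
Proof. by have := saP hm (-1) 0 0 x; rewrite scaler0 addr0 scaleN1r addNr. Qed.

Lemma star_actionZ c a x : m (c *: a) x = c *: m a x.
Proof. by have := saP hm c a 0 x; rewrite star_action0 !addr0. Qed.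

Lemma star_actionB a b x : m (a - b) x = m a x - m b x.
Proof. by rewrite star_actionD -(scaleN1r b) star_actionZ scaleN1r. Qed.

(** With [cstar b] b = 2 y - y^2 and y self-adjoint, |x|^2 - |b x|^2 is the square of the seminorm
    of x - y x. *)
Lemma star_action_contraction b x :
  nrm b ^+ 2 <= 3 / 4 -> snrm s (m b x) <= snrm s x.
Proof.
move=> b34; have [||y [yy hy]] := @cstar_sqrt R A (cstar b ∗ b).
- by rewrite cstarM cstarK.
- by rewrite nrm_cstar_mul.
rewrite -ler_sqr ?nnegrE ?snrm_ge0// -lecR -!snrmE// -subr_ge0.
suff -> : s x x - s (m b x) (m b x) = s (x - m y x) (x - m y x).
  exact: sip_ge0 hs _.
rewrite (sa_star hm b) -(sa_mul hm) hy star_actionB star_actionD (sa_mul hm).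
rewrite (sipBl hs) !(sipBr hs) !(sipDr hs) !(sa_star hm y) yy; ring.
Qed.

Lemma star_action_bound a x : snrm s (m a x) <= 2 * nrm a * snrm s x.
Proof.
have [->|a0] := eqVneq a 0.
  by rewrite star_action0 nrm0 mulr0 mul0r /snrm (sip0l hs) sqrtr0.
(* Rescaling to norm 1/2 keeps the square below 3/4, at the price of the factor 2. *)
have a_gt0 := nrm_gt0 a0; set b := ((2 * nrm a)^-1)%:C *: a.
have c0 : 0 < 2 * nrm a by rewrite mulr_gt0.
have b12 : nrm b = 2^-1.
  rewrite nrmZ nrm_real ?invr_ge0 ?ltW//; field; exact: lt0r_neq0.
have := @star_action_contraction b x; rewrite b12 /b star_actionZ snrmZ//.
rewrite nrm_real ?invr_ge0 ?(ltW c0)// => h.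
rewrite -ler_pdivrMl//; apply: h; lra.
Qed.

End StarAction.

(** * Representations have closed range *)

Section ClosedRange.
Variables (R : realType) (A : cstarAlgebra R).
Local Notation C := R[i].
Local Notation eps := (inv_succ R).
Local Notation "a ∗ b" := (cmul a b) (at level 40, left associativity).
Implicit Types a b h : A.

(* [cpow1 c h n] is (1 + c h)^n - 1, which makes sense without a unit. *)
Definition cpow1 (c : C) (h : A) (n : nat) : A :=
  iter n (fun v => v + (c *: h + c *: (h ∗ v))) 0.

(** For c imaginary and h self-adjoint the cross terms cancel, so one factor gives |(1 + c h) z|^2 =
    |[cstar z] z - c^2 [cstar (h z)] (h z)|. The growth is of second order in c. Letting the power
    act on x replaces the unit. *)
Lemma nrm_cpow1 (c : C) h n x : (c^*)%C = - c -> cstar h = h ->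
  nrm (x + cpow1 c h n ∗ x) ^+ 2 <=
    (1 + (nrm c * nrm h) ^+ 2) ^+ n * nrm x ^+ 2.
Proof.
move=> cc hh; elim: n => [|n IH]; first by rewrite expr0 cmul0l addr0 mul1r.
rewrite [cpow1 _ _ _]/=; set z := x + cpow1 c h n ∗ x in IH.
have -> : x + (cpow1 c h n + (c *: h + c *: (h ∗ cpow1 c h n))) ∗ x =
   z + c *: (h ∗ z).
  by rewrite /z !cmulDl !cmulZl cmulDr cmulA scalerDr !addrA.
clearbody z; rewrite (exprS _ n) -mulrA; apply: le_trans (ler_wpM2l _ IH); last first.
  by rewrite addr_ge0 ?sqr_ge0.
rewrite -nrm_cstar_mul cstarD cstarZ cstarM hh cc.
have -> : (cstar z + - c *: (cstar z ∗ h)) ∗ (z + c *: (h ∗ z)) =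
   cstar z ∗ z - (c * c) *: (cstar (h ∗ z) ∗ (h ∗ z)).
  rewrite cmulDl !cmulDr !cmulZl !cmulZr cstarM hh !cmulA.
  by rewrite scaleNr addrA -(addrA (_ ∗ _)) addrN addr0 scalerA mulNr scaleNr.
apply: le_trans (nrmB_le _ _) _; rewrite nrmZ !nrm_cstar_mul nrmM.
have := nrm_cmul h z; have := nrm_ge0 (h ∗ z); have := nrm_ge0 c.
have := nrm_ge0 z; have := nrm_ge0 h; rewrite mulrDl mul1r lerD2l => *.
rewrite -expr2 -exprMn -exprMn ler_sqr ?nnegrE ?mulr_ge0//.
by rewrite -mulrA ler_wpM2l.
Qed.

(** Each of the two powers at most doubles the norm of a vector. Applied to [cstar d] they give
    |d|^2 = |d [cstar d]| <= 4 |d|. *)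
Lemma nrm_cpow1_sub (c : C) h n : (c^*)%C = - c -> cstar h = h ->
  n%:R * (nrm c * nrm h) ^+ 2 <= 1 / 2 ->
  nrm (cpow1 c h n - cpow1 (- c) h n) <= 4.
Proof.
move=> cc hh n12; set d := _ - _.
have cc' : ((- c)^*)%C = - - c by rewrite conjcN cc.
have q0 := sqr_ge0 (nrm c * nrm h).
have b2 : (1 + (nrm c * nrm h) ^+ 2) ^+ n <= 4.
  have := bernoulli_inv n q0; have : 0 <= (1 + (nrm c * nrm h) ^+ 2) ^+ n.
    by rewrite exprn_ge0// addr_ge0.
  nra.
have le2 (e : C) x : (e^*)%C = - e -> nrm e = nrm c ->
    nrm (x + cpow1 e h n ∗ x) <= 2 * nrm x.
  move=> ee ec; rewrite -ler_sqr ?nnegrE ?nrm_ge0 ?mulr_ge0 ?nrm_ge0//.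
  apply: le_trans (nrm_cpow1 n x ee hh) _; rewrite ec [leRHS]exprMn ler_wpM2r ?sqr_ge0//.
  by apply: le_trans b2 _; rewrite -natrX.
have [d0|dn0] := eqVneq d 0; first by rewrite d0 nrm0.
rewrite -(ler_pM2r (nrm_gt0 dn0)) -expr2 -nrm_cstar -nrm_cstar_mul cstarK.
have -> : d ∗ cstar d =
   (cstar d + cpow1 c h n ∗ cstar d) - (cstar d + cpow1 (- c) h n ∗ cstar d).
  by rewrite opprD addrACA subrr add0r -cmulBl.
apply: le_trans (nrmB_le _ _) _.
have := le2 c (cstar d) cc erefl; have := le2 (- c) (cstar d) cc' (nrmN _).
rewrite !nrm_cstar; lra.
Qed.

Variables (H : hilbertSpace R) (pi : {bilinear A -> H -> H}).
Hypothesis hpi : is_representation pi.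

Lemma repD a b x : pi (a + b) x = pi a x + pi b x. Proof. exact: linearDl. Qed.
Lemma repB a b x : pi (a - b) x = pi a x - pi b x. Proof. exact: linearBl. Qed.
Lemma repZ c a x : pi (c *: a) x = c *: pi a x. Proof. exact: linearZl_LR. Qed.

Lemma rep_star_action : is_star_action (@hdot R H) pi.
Proof.
split=> [c a b x|a b x|a x y]; [exact: linearPl|exact: rep_mul|exact: rep_star].
Qed.

Lemma rep_bound a x : nrm (pi a x) <= 2 * nrm a * nrm x.
Proof.
by have := star_action_bound (@hdot_semi_ip R H) rep_star_action a x;
  rewrite !snrm_hdot.
Qed.

Lemma rep_star_bound a (M : R) : 0 <= M ->
  (forall x, nrm (pi a x) <= M * nrm x) -> forall x, nrm (pi (cstar a) x) <= M * nrm x.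
Proof.
move=> M0 aM x; apply: hdot_dual => [|z]; first by rewrite mulr_ge0 ?nrm_ge0.
rewrite (rep_star hpi) cstarK; apply: le_trans (hdot_cauchy_schwarz _ _) _.
by rewrite -mulrA mulrCA ler_wpM2l ?nrm_ge0.
Qed.

(** Comparison with the binomial expansion of (1 + q)^n, whose coefficients are nonnegative: the
    bounds are that expansion without its constant term, then without its linear term too. *)
Lemma rep_cpow1 (c : C) h n (M : R) x : 0 <= M ->
  (forall x, nrm (pi h x) <= M * nrm x) -> let q := nrm c * M in
  nrm (pi (cpow1 c h n) x) <= ((1 + q) ^+ n - 1) * nrm x /\
  nrm (pi (cpow1 c h n) x - (n%:R * c) *: pi h x) <=
    ((1 + q) ^+ n - 1 - n%:R * q) * nrm x.
Proof.
move=> M0 hM q; have q0 : 0 <= q by rewrite mulr_ge0 ?nrm_ge0.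
elim: n => [|n [IH1 IH2]].
  by rewrite linear0l !mul0r scale0r !subr0 nrm0 expr0 subrr mul0r.
rewrite [cpow1 _ _ _]/=; set v := cpow1 c h n in IH1 IH2 *.
have hb y : nrm (c *: pi h y) <= q * nrm y.
  by rewrite nrmZ /q -mulrA ler_wpM2l ?nrm_ge0.
have -> : pi (v + (c *: h + c *: (h ∗ v))) x =
    pi v x + (c *: pi h x + c *: pi h (pi v x)).
  by rewrite !repD !repZ (rep_mul hpi).
have h1 := hb x; have h2 := hb (pi v x); have h3 := ler_wpM2l q0 IH1.
rewrite exprS; set p := _ ^+ n in IH1 IH2 h3 *; split.
  apply: le_trans (nrmD_le _ _) _.
  have := nrmD_le (c *: pi h x) (c *: pi h (pi v x)); lra.
have -> : pi v x + (c *: pi h x + c *: pi h (pi v x)) - (n.+1%:R * c) *: pi h x =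
   (pi v x - (n%:R * c) *: pi h x) + c *: pi h (pi v x).
  rewrite -natr1 mulrDl mul1r scalerDl opprD addrACA.
  by rewrite (addrC (c *: pi h x)) addrK.
apply: le_trans (nrmD_le _ _) _; rewrite -[n.+1%:R]natr1; lra.
Qed.
End ClosedRange.

Section ClosedRangeTheorem.
Variables (R : realType) (A : cstarAlgebra R) (H : hilbertSpace R).
Variable pi : {bilinear A -> H -> H}.
Hypothesis hpi : is_representation pi.
Local Notation C := R[i].
Local Notation eps := (inv_succ R).
Implicit Types a b h : A.

(* With c = i t / n, (2 n c)^-1 ((1 + c h)^n - (1 - c h)^n) is close to
   sin (t h) / t, whose norm is at most 1 / t, whereas it is close to h in any
   representation in which t h is small. *)
Lemma rep_lift_selfadjoint h (M : R) : cstar h = h -> 0 < M ->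
  (forall x, nrm (pi h x) <= M * nrm x) ->
  exists b, nrm b <= 18 * M /\
    forall x, nrm (pi h x - pi b x) <= M / 8 * nrm x.
Proof.
(* With t M = 1/9 the remainder r is at most 9/8 - 1 - 1/9 = 1/72. The error is then 2 r / (2 t) <=
   M / 8, and the norm is at most 4 / (2 t) = 18 M. *)
move=> hh M0 hM; pose t := (9 * M)^-1; have t0 : 0 < t by rewrite invr_gt0 mulr_gt0.
have tM : 9 * (t * M) = 1 by rewrite /t; field; exact: lt0r_neq0.
(* Large enough for n |c h|^2 = (t |h|)^2 / n to be at most 1/2. *)
pose n := (Num.trunc (2 * (t * nrm h) ^+ 2)).+1.
have n0 : 0 < n%:R :> R by [].
have hn : 2 * (t * nrm h) ^+ 2 < n%:R by apply: truncnS_gt.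
clearbody n.
pose c : C := 0 +i* (t / n%:R).
have cc : (c^*)%C = - c by apply/eqP; rewrite eq_complex /= oppr0 !eqxx.
have nc : nrm c = t / n%:R.
  rewrite /nrm normc_def/= expr0n/= add0r sqrtr_sqr ger0_norm //.
  by rewrite divr_ge0 ?(ltW t0).
have n12 : n%:R * (nrm c * nrm h) ^+ 2 <= 1 / 2.
  rewrite nc; have -> : n%:R * (t / n%:R * nrm h) ^+ 2 = (t * nrm h) ^+ 2 / n%:R.
    by field; exact: lt0r_neq0.
  rewrite ler_pdivrMr//; lra.
have d4 := nrm_cpow1_sub cc hh n12; set d := _ - _ in d4.
have n2c : nrm (2 * n%:R * c) = 2 * t.
  rewrite !nrmM nc; have -> : (2 : C) = (2 : R)%:C by rewrite rmorph_nat.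
  have -> : (n%:R : C) = (n%:R : R)%:C by rewrite rmorph_nat.
  by rewrite !nrm_real//; field; exact: lt0r_neq0.
have c0 : 2 * n%:R * c != 0.
  apply/eqP => h0; move: n2c; rewrite h0 nrm0 => /eqP.
  by rewrite eq_sym mulf_eq0 pnatr_eq0/= gt_eqF.
have nV : nrm (2 * n%:R * c)^-1 = (2 * t)^-1.
  apply: (mulIf (x := 2 * t)); first by rewrite gt_eqF// mulr_gt0.
  rewrite -{1}n2c -nrmM mulVf// mulVf ?gt_eqF ?mulr_gt0//.
  by rewrite /nrm normr1.
exists ((2 * n%:R * c)^-1 *: d); split.
  rewrite nrmZ nV; have -> : 18 * M = (2 * t)^-1 * 4.
    by rewrite /t; field; exact: lt0r_neq0.
  by rewrite ler_wpM2l// invr_ge0 mulr_ge0 ?(ltW t0).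
move=> x; rewrite repZ /d repB.
have [_] := rep_cpow1 hpi c n x (ltW M0) hM.
have [_] := rep_cpow1 hpi (- c) n x (ltW M0) hM.
rewrite nrmN nc; set v := pi (cpow1 c h n) x; set w := pi (cpow1 (- c) h n) x.
set k := pi h x; set r := (1 + _) ^+ n - _ - _ => h1 h2.
have hr : r <= 1 / 72.
  rewrite /r; have nq : n%:R * (t / n%:R * M) = 1 / 9.
    rewrite mulrA mulrCA divff ?gt_eqF// mulr1; lra.
  have q0 : 0 <= t / n%:R * M by rewrite mulr_ge0 ?(ltW M0)// divr_ge0// ltW.
  have := bernoulli_inv n q0; rewrite nq; lra.
have -> : k - (2 * n%:R * c)^-1 *: (v - w) =
  (2 * n%:R * c)^-1 *: ((w - (n%:R * - c) *: k) - (v - (n%:R * c) *: k)).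
  have kE : k = (2 * n%:R * c)^-1 *: ((2 * n%:R * c) *: k).
    by rewrite scalerA mulVf// scale1r.
  rewrite {1}kE -scalerBr; congr (_ *: _).
  rewrite mulrN scaleNr opprK !opprB -[2 * _ * c]mulrA mulr_natl mulr2n scalerDl.
  by rewrite addrACA (addrC w).
rewrite nrmZ nV.
have h3 := nrmB_le (w - (n%:R * - c) *: k) (v - (n%:R * c) *: k).
have x0 := nrm_ge0 x; have h4 : r * nrm x <= 1 / 72 * nrm x by rewrite ler_wpM2r.
rewrite ler_pdivrMl ?mulr_gt0//; apply: le_trans h3 _.
have -> : 2 * t * (M / 8 * nrm x) = (9 * (t * M)) * (nrm x / 36) by field.
rewrite tM; lra.
Qed.

(** Real and imaginary parts of a are lifted separately, which doubles both constants of the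
    self-adjoint case. *)
Lemma rep_lift a (M : R) : 0 < M -> (forall x, nrm (pi a x) <= M * nrm x) ->
  exists b, nrm b <= 36 * M /\ forall x, nrm (pi a x - pi b x) <= M / 4 * nrm x.
Proof.
move=> M0 aM; have aM' := rep_star_bound hpi (ltW M0) aM.
pose I : C := 0 +i* 1.
have II : I * I = -1 by rewrite -sqr_i.
have Ic : (I^*)%C = - I by apply/eqP; rewrite eq_complex /= oppr0 !eqxx.
have I1 : nrm I = 1 by rewrite /nrm normc_def/= expr0n/= add0r expr1n sqrtr1.
have half : nrm (2^-1 : R)%:C = 2^-1 by rewrite nrm_real.
pose h := (2^-1 : R)%:C *: (a + cstar a).
pose k := (- I * (2^-1 : R)%:C) *: (a - cstar a).
have hh : cstar h = h by rewrite cstarZ cstarD cstarK conjc_real addrC.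
have kk : cstar k = k.
  rewrite cstarZ cstarB cstarK conjcM conjcN Ic opprK conjc_real.
  by rewrite -opprB scalerN -scaleNr /k mulNr.
have ahk : a = h + I *: k.
  have h1 : 2^-1 + 2^-1 = 1 :> R by field.
  rewrite /h /k scalerA mulrA mulrN II opprK mul1r -scalerDr addrACA subrr addr0.
  by rewrite scalerDr -scalerDl -rmorphD/= h1 scale1r.
have hM x : nrm (pi h x) <= M * nrm x.
  rewrite repZ repD nrmZ half.
  have := nrmD_le (pi a x) (pi (cstar a) x); have := aM x; have := aM' x; lra.
have kM x : nrm (pi k x) <= M * nrm x.
  rewrite repZ repB nrmZ nrmM nrmN I1 half.
  have := nrmB_le (pi a x) (pi (cstar a) x); have := aM x; have := aM' x; lra.
clearbody h k.
have [h' [h1 h2]] := rep_lift_selfadjoint hh M0 hM.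
have [k' [k1 k2]] := rep_lift_selfadjoint kk M0 kM.
exists (h' + I *: k'); split.
  by apply: le_trans (nrmD_le _ _) _; rewrite nrmZ I1; lra.
move=> x; rewrite {1}ahk !repD !repZ opprD addrACA -scalerBr.
apply: le_trans (nrmD_le _ _) _; rewrite nrmZ I1.
have := h2 x; have := k2 x; lra.
Qed.

(** Successive approximation: the residual T - pi(a) is halved by corrections whose norms are
    summable, so the corrected elements converge in A. *)
Theorem rep_closed_range (T : H -> H) :
  (forall e : R, 0 < e -> exists a, forall x, nrm (T x - pi a x) <= e * nrm x) ->
  exists a, forall x, T x = pi a x.
Proof.
move=> TA.
pose good n a := forall x, nrm (T x - pi a x) <= (2^-1) ^+ n * nrm x.
have p0 n : 0 < (2^-1 : R) ^+ n by rewrite exprn_gt0// invr_gt0.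
have step n a : good n a ->
    exists b, good n.+1 b /\ nrm (b - a) <= 41 * (2^-1) ^+ n.
  (* With p = 2^-n, approximate T within p / 8, so a' - a has image of norm at most 9 p / 8. Its
     lift has norm at most 36 * 9 p / 8 <= 41 p and leaves the error 9 p / 32 + p / 8 <= p / 2. *)
  move=> ga; have e0 : 0 < (2^-1 : R) ^+ n / 8 by rewrite divr_gt0.
  have [a' Ha'] := TA _ e0; set p := (2^-1 : R) ^+ n in ga e0 Ha' *.
  have q0 : 0 < 9 / 8 * p by rewrite mulr_gt0// /p.
  have [x|b [b1 b2]] := @rep_lift (a' - a) (9 / 8 * p) q0.
    rewrite repB; have := nrm_dist (T x) (pi a' x) (pi a x).
    rewrite (nrmB (pi a' x) (T x)); have := Ha' x; have := ga x; rewrite -/p; lra.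
  exists (a + b); split; last first.
    by rewrite addrAC subrr add0r; have := p0 n; rewrite -/p; lra.
  move=> x; rewrite exprS -/p repD.
  have := nrm_dist (pi a' x) (T x) (pi a x + pi b x).
  have := Ha' x; have := b2 x; rewrite repB.
  have -> : pi a' x - pi a x - pi b x = pi a' x - (pi a x + pi b x).
    by rewrite opprD addrA.
  have := mulr_ge0 (ltW (p0 n)) (nrm_ge0 x); rewrite -/p; lra.
have [a0 Ha0] : exists a, good 0%N a by apply: TA; rewrite expr0.
(* A total version, with a itself as default, allows the sequence to be defined by plain
   recursion. *)
have step' n a : exists b, good n a ->
    good n.+1 b /\ nrm (b - a) <= 41 * (2^-1) ^+ n.
  have [/step[b Hb]|ng] := pselect (good n a); first by exists b.
  by exists a.
pose nxt n a := projT1 (cid (step' n a)).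
pose u := fix u n := if n is n'.+1 then nxt n' (u n') else a0.
have gu n : good n (u n).
  by elim: n => [//|n IH]; have [] := projT2 (cid (step' n (u n))) IH.
have uS n : nrm (u n.+1 - u n) <= 41 * (2^-1) ^+ n.
  by have [] := projT2 (cid (step' n (u n))) (gu n).
have uD n k : nrm (u (n + k)%N - u n) <= 82 * ((2^-1) ^+ n - (2^-1) ^+ (n + k)).
  elim: k => [|k IH]; first by rewrite addn0 !subrr nrm0 mulr0.
  rewrite addnS; apply: le_trans (nrm_dist (u (n + k)%N) _ _) _.
  have := uS (n + k)%N; rewrite (exprS _ (n + k)); lra.
have [|m n nm|a Ha] := @nrm_seq_complete R A u 82; first by [].
  rewrite -(subnKC nm); apply: le_trans (uD _ _) _; rewrite ler_wpM2l//.
  have := half_pow_le R n; have := p0 (n + (m - n))%N; lra.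
exists a => x; apply/eqP; rewrite -subr_eq0; apply/eqP.
apply: (@nrm_inv_succ _ _ _ ((1 + 2 * (2 * 82)) * nrm x)) => n.
apply: le_trans (nrm_dist (pi (u n) x) _ _) _.
have h1 := gu n x; have h2 := rep_bound hpi (u n - a) x.
rewrite repB in h2; have h3 := half_pow_le R n.
have h4 := ler_wpM2r (nrm_ge0 x) h3; have h5 := ler_wpM2r (nrm_ge0 x) (Ha n).
lra.
Qed.

End ClosedRangeTheorem.

(** * Irreducible representations and induction *)

Section Irreducible.
Variables (R : realType) (A : cstarAlgebra R) (H : hilbertSpace R).
Variable pi : {bilinear A -> H -> H}.
Hypothesis ipi : is_irreducible pi.
Local Notation C := R[i].

Let hpi := irr_representation ipi.

Lemma irr_subspace (V : set H) : V 0 ->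
  (forall c x y, V x -> V y -> V (c *: x + y)) ->
  (forall a x, V x -> V (pi a x)) ->
  limit_closed V ->
  (forall x, V x -> x = 0) \/ (forall x, V x).
Proof.
move=> V0 Vlin Vpi /closed_nrm Vcl.
have [->|->] := irr_invariant ipi Vcl V0 Vlin Vpi; first by left.
by right.
Qed.

Lemma rep_linear a : linear (pi a).
Proof. by move=> c x y; rewrite linearPr. Qed.

Lemma rep_bounded_linear a : bounded_linear (pi a).
Proof.
split; first exact: rep_linear.
exists (2 * nrm a); split; first by rewrite mulr_ge0 ?nrm_ge0.
by move=> x; apply: rep_bound.
Qed.

Lemma lipschitz_rep x : lipschitz_map (pi^~ x).
Proof.
exists (2 * nrm x); split; first by rewrite mulr_ge0 ?nrm_ge0.
by move=> a b /=; rewrite -repB mulrAC rep_bound.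
Qed.

(** The vectors killed by A form a closed invariant subspace, which is not H since pi is not
    zero. *)
Lemma irr_nondegenerate x : (forall a, pi a x = 0) -> x = 0.
Proof.
have [||||h|h] := @irr_subspace [set x | forall a, pi a x = 0].
- by move=> a; rewrite linear0r.
- by move=> c y z /= Hy Hz a; rewrite linearPr Hy Hz scaler0 addr0.
- by move=> a y /= Hy b; rewrite -(rep_mul hpi).
- apply: limit_closed_forall => a; apply: limit_closed_preimage (@limit_closed0 _ _) _.
  exact: bounded_linear_lipschitz (rep_bounded_linear a).
- exact: h.
have [a [z /eqP az]] := irr_nonzero ipi; by have := h z a.
Qed.

(** The closure of pi(A) x is invariant. Without a unit it need not visibly contain x; if it were 0,
    then A would kill x, against nondegeneracy. *)
Lemma irr_cyclic x : x != 0 -> dense_map (fun a => pi a x).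
Proof.
move=> x0; pose V := [set y | forall e : R, 0 < e -> exists a, nrm (y - pi a x) < e].
have [||||h|h] := @irr_subspace V.
- by move=> e e0; exists 0; rewrite linear0l subr0 nrm0.
- move=> c y z Hy Hz e e0.
  have D0 : 0 < nrm c + 1 by rewrite ltr_wpDl ?nrm_ge0.
  have [a ya] := Hy _ (divr_gt0 e0 D0); have [b zb] := Hz _ (divr_gt0 e0 D0).
  exists (c *: a + b); rewrite repD repZ opprD addrACA -scalerBr.
  apply: le_lt_trans (nrmD_le _ _) _; rewrite nrmZ.
  set d := e / _ in ya zb; have <- : d * (nrm c + 1) = e by rewrite divfK// gt_eqF.
  have := ler_wpM2l (nrm_ge0 c) (ltW ya); lra.
- move=> a y Hy e e0; have D0 : 0 < 2 * nrm a + 1 by rewrite ltr_wpDl ?mulr_ge0 ?nrm_ge0.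
  have [b yb] := Hy _ (divr_gt0 e0 D0); exists (cmul a b).
  rewrite (rep_mul hpi) -(linear_funB _ _ (rep_linear a)).
  apply: le_lt_trans (rep_bound hpi _ _) _; set d := e / _ in yb.
  have <- : d * (2 * nrm a + 1) = e by rewrite divfK// gt_eqF.
  have d0 : 0 < d by rewrite divr_gt0.
  have := ler_wpM2l (mulr_ge0 (ler0n _ 2) (nrm_ge0 a)) (ltW yb); lra.
- move=> y Hy e e0; have e20 : 0 < e / 2 by rewrite divr_gt0.
  have [z Hz yz] := Hy _ e20; have [a za] := Hz _ e20; exists a.
  by apply: le_lt_trans (nrm_dist z _ _) _; rewrite (splitr e) ltrD.
- exfalso; move/eqP: x0; apply; apply: irr_nondegenerate => a; apply: h => e e0.
  by exists a; rewrite subrr nrm0.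
by move=> y e e0; have [a ya] := h y e e0; exists a; exact: ltW.
Qed.

End Irreducible.

(* The part of the structure of an imprimitivity bimodule which is used in one
   direction.  [mo_full] says that the inner products generate a dense subspace. *)
Record morita_context (R : realType) (A B : cstarAlgebra R) (X : lmodType R[i])
    (la : A -> X -> X) (ra : X -> B -> X) (lip : X -> X -> A) (rip : X -> X -> B)
    : Prop := {
  mo_lal : forall c a b x, la (c *: a + b) x = c *: la a x + la b x ;
  mo_lar : forall c a x y, la a (c *: x + y) = c *: la a x + la a y ;
  mo_laM : forall a b x, la (cmul a b) x = la a (la b x) ;
  mo_rar : forall c x a b, ra x (c *: a + b) = c *: ra x a + ra x b ;
  mo_raM : forall x a b, ra x (cmul a b) = ra (ra x a) b ;
  mo_la_ra : forall a x b, ra (la a x) b = la a (ra x b) ;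
  mo_ripr : forall c x y z, rip x (c *: y + z) = c *: rip x y + rip x z ;
  mo_ripC : forall x y, cstar (rip x y) = rip y x ;
  mo_ripM : forall x y b, rip x (ra y b) = cmul (rip x y) b ;
  mo_rip_ge0 : forall x, cpositive (rip x x) ;
  mo_rip_la : forall a x y, rip (la a x) y = rip x (la (cstar a) y) ;
  mo_ip : forall x y z, la (lip x y) z = ra x (rip y z) ;
  mo_full : forall S : set B, S 0 ->
    (forall c a b, S a -> S b -> S (c *: a + b)) ->
    limit_closed S ->
    (forall x y, S (rip x y)) -> forall b, S b
}.

(** * The induced representation and its intertwining operators *)

Section Induction.
Variables (R : realType) (A B : cstarAlgebra R) (X : lmodType R[i]).
Variables (la : A -> X -> X) (ra : X -> B -> X).
Variables (lip : X -> X -> A) (rip : X -> X -> B).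
Hypothesis mo : morita_context la ra lip rip.
Variables (H : hilbertSpace R) (pi : {bilinear B -> H -> H}) (xi : H).
Hypotheses (ipi : is_irreducible pi) (xi0 : xi != 0).
Local Notation C := R[i].
Local Notation "a ∗ b" := (cmul a b) (at level 40, left associativity).

Let hpi := irr_representation ipi.

(* GNS-type form: since xi is cyclic, completing X for it yields the tensor
   product of X and H over B. *)
Definition induced_ip (x y : X) : C := hdot (pi (rip y x) xi) xi.
Local Notation s := induced_ip.

Lemma induced_semi_ip : semi_ip s.
Proof.
split=> [c x y z|x y|x].
- by rewrite /s (mo_ripr mo) repD repZ (sip_linear (@hdot_semi_ip R H)).
- by rewrite /s -(mo_ripC mo) (rep_star hpi) cstarK (sipC (@hdot_semi_ip R H)).
have [c hc] := mo_rip_ge0 mo x.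
by rewrite /s hc (rep_mul hpi) (rep_star hpi) cstarK sip_ge0//; exact: hdot_semi_ip.
Qed.
Let hs := induced_semi_ip.

Lemma induced_star_action : is_star_action s la.
Proof.
split=> [c a b x|a b x|a x y]; [exact: mo_lal mo _ _ _ _|exact: mo_laM mo _ _ _|].
by rewrite /s (mo_rip_la mo) cstarK.
Qed.

Local Notation K := (hilbert_completion hs).
Local Notation j := (completion_in hs : X -> K).

Lemma cyclic_linear : linear (fun b => pi b xi).
Proof. by move=> c a b; rewrite repD repZ. Qed.

Lemma cyclic_dense : dense_map (fun b => pi b xi).
Proof. exact: irr_cyclic. Qed.

(** The square of the left side is the form at (<x, x>_A y, y), so the bound of the star action
    applies. *)
Lemma induced_adj_bound x y :
  nrm (pi (rip x y) xi) <= (1 + 2 * nrm (lip x x)) * snrm s y.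
Proof.
apply: sqr_le_bound; rewrite ?mulr_ge0 ?nrm_ge0 ?snrm_ge0//.
rewrite -[leLHS]nrm_real ?sqr_ge0// -hdot_nrm.
have -> : hdot (pi (rip x y) xi) (pi (rip x y) xi) = s (la (lip x x) y) y.
  rewrite /s (mo_ip mo) (mo_ripM mo) (rep_mul hpi) (rep_star hpi (rip y x)).
  by rewrite (mo_ripC mo).
apply: le_trans (cauchy_schwarz hs _ _) _; rewrite expr2 mulrA.
by rewrite ler_wpM2r ?snrm_ge0// (star_action_bound hs induced_star_action).
Qed.

(** The form at (x b, x b) equals <pi(<x, x>_B) v, v> with v = pi(b) xi. *)
Lemma induced_fwd_bound x b :
  snrm s (ra x b) <= (1 + 2 * nrm (rip x x)) * nrm (pi b xi).
Proof.
apply: sqr_le_bound; rewrite ?mulr_ge0 ?nrm_ge0 ?snrm_ge0//.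
rewrite -[leLHS]nrm_real ?sqr_ge0// -(snrmE hs).
have -> : s (ra x b) (ra x b) = hdot (pi (rip x x) (pi b xi)) (pi b xi).
  have -> : s (ra x b) (ra x b) = hdot (pi (cstar b ∗ (rip x x ∗ b)) xi) xi.
    by rewrite /s (mo_ripM mo) -(mo_ripC mo x) (mo_ripM mo) cstarM (mo_ripC mo) cmulA.
  by rewrite !(rep_mul hpi) (rep_star hpi (cstar b)) cstarK.
apply: le_trans (hdot_cauchy_schwarz _ _) _; rewrite expr2 mulrA.
by rewrite ler_wpM2r ?nrm_ge0// rep_bound.
Qed.

Lemma completion_in_dense : dense_map j.
Proof. by move=> k e e0; have [u ku] := completion_dense k e0; exists u. Qed.

Lemma exists_sigma (a : A) : exists T : K -> K,
  linear T /\ (forall k, nrm (T k) <= 2 * nrm a * nrm k) /\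
  forall x, T (j x) = j (la a x).
Proof.
apply: (@bounded_extension R X K K j (fun x => j (la a x)) (2 * nrm a)).
- exact: completion_in_linear.
- by move=> c x y; rewrite (mo_lar mo) linearP.
- exact: completion_in_dense.
- by rewrite mulr_ge0 ?nrm_ge0.
- by move=> x; rewrite !completion_in_nrm (star_action_bound hs induced_star_action).
Qed.

(** As [j y] stands for y (x) xi, this is the usual map sending y (x) xi to pi(<x, y>_B) xi. *)
Lemma exists_adj (x : X) : exists T : K -> H,
  bounded_linear T /\ forall y, T (j y) = pi (rip x y) xi.
Proof.
have [||||y|T [lT [bT HT]]] := @bounded_extension R X K H j
    (fun y => pi (rip x y) xi) (1 + 2 * nrm (lip x x)).
- exact: completion_in_linear.
- by move=> c y z; rewrite (mo_ripr mo) repD repZ.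
- exact: completion_in_dense.
- by rewrite addr_ge0 ?mulr_ge0 ?nrm_ge0.
- by rewrite completion_in_nrm induced_adj_bound.
exists T; split=> //; split=> //; exists (1 + 2 * nrm (lip x x)); split=> //.
by rewrite addr_ge0 ?mulr_ge0 ?nrm_ge0.
Qed.

(** Comes from x (x) pi(b) xi = x b (x) xi; the bound makes the value depend on pi(b) xi only. *)
Lemma exists_fwd (x : X) : exists T : H -> K,
  bounded_linear T /\ forall b, T (pi b xi) = j (ra x b).
Proof.
have [||||b|T [lT [bT HT]]] := @bounded_extension R B H K (fun b => pi b xi)
    (fun b => j (ra x b)) (1 + 2 * nrm (rip x x)).
- exact: cyclic_linear.
- by move=> c a b; rewrite (mo_rar mo) linearP.
- exact: cyclic_dense.
- by rewrite addr_ge0 ?mulr_ge0 ?nrm_ge0.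
- by rewrite completion_in_nrm induced_fwd_bound.
exists T; split=> //; split=> //; exists (1 + 2 * nrm (rip x x)); split=> //.
by rewrite addr_ge0 ?mulr_ge0 ?nrm_ge0.
Qed.

Definition sigma (a : A) : K -> K := projT1 (cid (exists_sigma a)).
Definition adj (x : X) : K -> H := projT1 (cid (exists_adj x)).
Definition fwd (x : X) : H -> K := projT1 (cid (exists_fwd x)).

Lemma sigma_linear a : linear (sigma a).
Proof. by have [] := projT2 (cid (exists_sigma a)). Qed.
Lemma sigma_bound a k : nrm (sigma a k) <= 2 * nrm a * nrm k.
Proof. by have [_ [h _]] := projT2 (cid (exists_sigma a)); exact: h. Qed.
Lemma sigma_in a x : sigma a (j x) = j (la a x).
Proof. by have [_ [_ h]] := projT2 (cid (exists_sigma a)); exact: h. Qed.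
Lemma adj_bounded x : bounded_linear (adj x).
Proof. by have [] := projT2 (cid (exists_adj x)). Qed.
Lemma adj_in x y : adj x (j y) = pi (rip x y) xi.
Proof. by have [_ h] := projT2 (cid (exists_adj x)); exact: h. Qed.
Lemma fwd_bounded x : bounded_linear (fwd x).
Proof. by have [] := projT2 (cid (exists_fwd x)). Qed.
Lemma fwd_cyclic x b : fwd x (pi b xi) = j (ra x b).
Proof. by have [_ h] := projT2 (cid (exists_fwd x)); exact: h. Qed.

Lemma sigma_bounded a : bounded_linear (sigma a).
Proof.
split; first exact: sigma_linear.
by exists (2 * nrm a); split; [rewrite mulr_ge0 ?nrm_ge0|exact: sigma_bound].
Qed.

Let lip_sigma a := bounded_linear_lipschitz (sigma_bounded a).
Let lip_adj x := bounded_linear_lipschitz (adj_bounded x).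
Let lip_fwd x := bounded_linear_lipschitz (fwd_bounded x).
Let lip_pi b := bounded_linear_lipschitz (rep_bounded_linear ipi b).

Lemma hdot_in x y : hdot (j x) (j y) = s x y.
Proof. exact: completion_dot_in. Qed.

Lemma fwd_adj x z k : hdot (fwd x z) k = hdot z (adj x k).
Proof.
move: k; apply: (@lipschitz_dense_eq R X K C j) => [||| y].
- exact: completion_in_dense.
- exact: lipschitz_hdotr.
- exact: (lipschitz_comp (lipschitz_hdotr z) (lip_adj x)).
move: z; apply: (@lipschitz_dense_eq R B H C _ _ _ cyclic_dense) => [||b].
- exact: (lipschitz_comp (lipschitz_hdotl (j y)) (lip_fwd x)).
- exact: lipschitz_hdotl.
rewrite fwd_cyclic hdot_in adj_in /s (mo_ripM mo) (rep_mul hpi) (rep_star hpi).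
by rewrite (mo_ripC mo).
Qed.

Lemma hdot_adj x k : hdot k (j x) = hdot (adj x k) xi.
Proof.
move: k; apply: (@lipschitz_dense_eq R X K C j) => [||| y].
- exact: completion_in_dense.
- exact: lipschitz_hdotl.
- exact: (lipschitz_comp (lipschitz_hdotl xi) (lip_adj x)).
by rewrite hdot_in adj_in.
Qed.

(** No b with pi(b) xi = xi is at hand, so the equality is tested against K through the adjoint. *)
Lemma fwd_xi x : fwd x xi = j x.
Proof.
apply: hdot_ext => k; rewrite fwd_adj (sipC (@hdot_semi_ip R H)) -hdot_adj.
by rewrite -(sipC (@hdot_semi_ip R K)).
Qed.

Lemma fwd_adj_sigma x y k : fwd x (adj y k) = sigma (lip x y) k.
Proof.
move: k; apply: (@lipschitz_dense_eq R X K K j) => [||| z].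
- exact: completion_in_dense.
- exact: (lipschitz_comp (lip_fwd x) (lip_adj y)).
- exact: lip_sigma.
by rewrite adj_in fwd_cyclic sigma_in (mo_ip mo).
Qed.

Lemma adj_fwd x y z : adj x (fwd y z) = pi (rip x y) z.
Proof.
move: z; apply: (@lipschitz_dense_eq R B H H _ _ _ cyclic_dense) => [||b].
- exact: (lipschitz_comp (lip_adj x) (lip_fwd y)).
- exact: lip_pi.
by rewrite fwd_cyclic adj_in (mo_ripM mo) (rep_mul hpi).
Qed.

Lemma sigma_fwd a y z : sigma a (fwd y z) = fwd (la a y) z.
Proof.
move: z; apply: (@lipschitz_dense_eq R B H K _ _ _ cyclic_dense) => [||b].
- exact: (lipschitz_comp (lip_sigma a) (lip_fwd y)).
- exact: lip_fwd.
by rewrite !fwd_cyclic sigma_in (mo_la_ra mo).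
Qed.

Lemma fwd_pi x b z : fwd x (pi b z) = fwd (ra x b) z.
Proof.
move: z; apply: (@lipschitz_dense_eq R B H K _ _ _ cyclic_dense) => [||c].
- exact: (lipschitz_comp (lip_fwd x) (lip_pi b)).
- exact: lip_fwd.
by rewrite -(rep_mul hpi) !fwd_cyclic (mo_raM mo).
Qed.

Lemma sigma_linearl c a b k : sigma (c *: a + b) k = c *: sigma a k + sigma b k.
Proof.
move: k; apply: (@lipschitz_dense_eq R X K K j) => [|||x].
- exact: completion_in_dense.
- exact: lip_sigma.
- have [M [M0 HM]] := lip_sigma a; have [N [N0 HN]] := lip_sigma b.
  exists (nrm c * M + N); split; first by rewrite addr_ge0 ?mulr_ge0 ?nrm_ge0.
  move=> k l; rewrite opprD addrACA -scalerBr; apply: le_trans (nrmD_le _ _) _.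
  by rewrite nrmZ mulrDl lerD// -mulrA ler_wpM2l ?nrm_ge0.
by rewrite !sigma_in (mo_lal mo) linearP.
Qed.

Lemma sigmaM a b k : sigma (a ∗ b) k = sigma a (sigma b k).
Proof.
move: k; apply: (@lipschitz_dense_eq R X K K j) => [|||x].
- exact: completion_in_dense.
- exact: lip_sigma.
- exact: (lipschitz_comp (lip_sigma a) (lip_sigma b)).
by rewrite !sigma_in (mo_laM mo).
Qed.

Lemma sigma_star a k l : hdot (sigma a k) l = hdot k (sigma (cstar a) l).
Proof.
move: k; apply: (@lipschitz_dense_eq R X K C j) => [|||x].
- exact: completion_in_dense.
- exact: (lipschitz_comp (lipschitz_hdotl l) (lip_sigma a)).
- exact: lipschitz_hdotl.
move: l; apply: (@lipschitz_dense_eq R X K C j) => [|||y].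
- exact: completion_in_dense.
- exact: lipschitz_hdotr.
- exact: (lipschitz_comp (lipschitz_hdotr (j x)) (lip_sigma (cstar a))).
by rewrite !sigma_in !hdot_in (sa_star induced_star_action).
Qed.

Fact sigma_zmodl k : zmod_morphism (sigma^~ k).
Proof.
by move=> a b /=; rewrite addrC -scaleN1r sigma_linearl scaleN1r addrC.
Qed.
Fact sigma_zmodr a : zmod_morphism (sigma a).
Proof. by move=> k l; rewrite (linear_funB _ _ (sigma_linear a)). Qed.
Fact sigma_scalel k : scalable_for *:%R (sigma^~ k).
Proof.
move=> c a /=; have := sigma_linearl c a 0 k; rewrite addr0 => ->.
by have := sigma_zmodl k 0 0; rewrite /= !subrr => ->; rewrite addr0.
Qed.
Fact sigma_scaler a : scalable_for *:%R (sigma a).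
Proof. by move=> c k; rewrite (linear_funZ _ _ (sigma_linear a)). Qed.

Definition induced_rep : {bilinear A -> K -> K} :=
  HB.pack sigma (isBilinear.Build _ _ _ _ _ _ sigma sigma_zmodl sigma_zmodr
    sigma_scalel sigma_scaler).

Lemma induced_is_representation : is_representation induced_rep.
Proof.
split=> [a|a b k|a k l]; [|exact: sigmaM|exact: sigma_star].
by apply: (@bound_continuous R K K _ (2 * nrm a)); exact: sigma_bound.
Qed.

(** Otherwise pi(<x, y>_B) xi = T_x F_y xi = 0, so by fullness <pi(b) xi, xi> = 0 for all b. Taking
    products [cstar b] b gives pi(b) xi = 0, hence xi = 0. *)
Lemma fwd_faithful : (forall x, fwd x xi = 0) -> False.
Proof.
move=> f0; have rip0 b : hdot (pi b xi) xi = 0.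
  move: b; apply: (mo_full mo (S := [set b | hdot (pi b xi) xi = 0])) => /=.
  - by rewrite linear0l (sip0l (@hdot_semi_ip R H)).
  - move=> c a b ha hb; rewrite repD repZ (sip_linear (@hdot_semi_ip R H)) ha hb.
    by rewrite mulr0 addr0.
  - apply: limit_closed_preimage (@limit_closed0 _ _) _.
    exact: (lipschitz_comp (lipschitz_hdotl xi) (lipschitz_rep ipi xi)).
  move=> x y; rewrite -adj_fwd f0 (linear_fun0 (adj_bounded x).1).
  exact: (sip0l (@hdot_semi_ip R H)).
move/eqP: xi0; apply; apply: (irr_nondegenerate ipi) => b; apply: hdot_eq0.
by rewrite (rep_star hpi) -(rep_mul hpi) (sipC (@hdot_semi_ip R H)) rip0 conjc0.
Qed.

(** An invariant V of K is pulled back to the set of z with F_x z in V for all x, which is closed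
    and invariant in H, hence 0 or H. *)
Lemma induced_irreducible : is_irreducible induced_rep.
Proof.
split; first exact: induced_is_representation.
(* If sigma vanishes, so do all F_x T_y. The common kernel of the F_x is 0 or H: in the first case
   the T_y vanish, in the second the F_x do. *)
- apply: contrapT => h.
  have sig0 a k : sigma a k = 0.
    by apply: contrapT => /eqP ak; apply: h; exists a, k.
  have [||||h0|h0] := @irr_subspace _ _ _ _ ipi [set z | forall x, fwd x z = 0].
  + by move=> x; rewrite (linear_fun0 (fwd_bounded x).1).
  + by move=> c y z /= hy hz x; rewrite (fwd_bounded x).1 hy hz scaler0 addr0.
  + by move=> b z /= hz x; rewrite fwd_pi hz.
  + apply: limit_closed_forall => x; apply: limit_closed_preimage (@limit_closed0 _ _) _.
    exact: lip_fwd.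
  + have rip0 b : pi b xi = 0.
      move: b; apply: (mo_full mo (S := [set b | pi b xi = 0])) => /=.
      * by rewrite linear0l.
      * by move=> c a b ha hb; rewrite repD repZ ha hb scaler0 addr0.
      * apply: limit_closed_preimage (@limit_closed0 _ _) _; exact: (lipschitz_rep ipi).
      by move=> x y; apply: h0 => z; rewrite -adj_in fwd_adj_sigma sig0.
    by move/eqP: xi0; apply; apply: (irr_nondegenerate ipi).
  by apply: fwd_faithful => x; apply: h0.
move=> V Vcl V0 Vlin Vsig.
have /closed_nrm Vcl' := Vcl.
have [||||h0|h0] := @irr_subspace _ _ _ _ ipi [set z | forall x, V (fwd x z)].
- by move=> x; rewrite (linear_fun0 (fwd_bounded x).1).
- by move=> c y z /= hy hz x; rewrite (fwd_bounded x).1; apply: Vlin.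
- by move=> b z /= hz x; rewrite fwd_pi.
- apply: limit_closed_forall => x; apply: limit_closed_preimage (lip_fwd x).
  exact: Vcl'.
(* For k in V, F_y T_x k = sigma(<y, x>_A) k stays in V, so T_x k lies in the pullback and vanishes;
   hence k is orthogonal to every [j x]. *)
- left; apply/seteqP; split=> [k Vk|_ ->//].
  apply: (@hdot_ext R K k 0) => l; rewrite (sip0l (@hdot_semi_ip R K)).
  move: l; apply: (@lipschitz_dense_eq R X K C j) => [|||x].
  + exact: completion_in_dense.
  + exact: lipschitz_hdotr.
  + by exists 0; split=> // x y; rewrite subrr nrm0 mul0r.
  rewrite hdot_adj (h0 (adj x k)) ?(sip0l (@hdot_semi_ip R H))// => y.
  by rewrite fwd_adj_sigma; apply: Vsig.
(* Now V contains every [j x], which is F_x xi, and these are dense. *)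
right; apply/seteqP; split=> // k _; apply: Vcl' => e e0.
have [x kx] := completion_in_dense k (divr_gt0 e0 (ltr0Sn R 1)).
exists (j x); first by rewrite -fwd_xi; apply: h0.
by apply: le_lt_trans kx _; rewrite ltr_pdivrMr// ltr_pMr// ltr1n.
Qed.

Theorem morita_induction : exists (K' : hilbertSpace R)
    (sg : {bilinear A -> K' -> K'}) (F : X -> H -> K') (T : X -> K' -> H),
  is_irreducible sg /\
  (forall x, bounded_linear (F x) /\ bounded_linear (T x)) /\
  (forall x z k, hdot (F x z) k = hdot z (T x k)) /\
  [/\ forall x y k, F x (T y k) = sg (lip x y) k,
      forall x y z, T x (F y z) = pi (rip x y) z &
      forall a x z, sg a (F x z) = F (la a x) z].
Proof.
exists K, induced_rep, fwd, adj.
split; first exact: induced_irreducible.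
split; first by move=> x; split; [exact: fwd_bounded|exact: adj_bounded].
split; first exact: fwd_adj.
by split; [exact: fwd_adj_sigma|exact: adj_fwd|exact: sigma_fwd].
Qed.

End Induction.

(** * Compact operators *)

Section TotallyBoundedOperators.
Variable R : realType.
Local Notation C := R[i].

Definition unit_ball (V : normedModType C) := [set v : V | nrm v <= 1].

Arguments unit_ball : clear implicits.

Definition tb_operator (V W : normedModType C) (T : V -> W) :=
  totally_bounded (T @` unit_ball V).

Lemma compact_operatorsE (H : hilbertSpace R) (T : H -> H) :
  compact_operators T <-> linear T /\ tb_operator T.
Proof.
have -> : compact_operators T =
    (linear T /\ precompact (T @` [set x | `|x| <= 1])) by [].
have -> : [set x : H | `|x| <= 1] = unit_ball H.
  by apply/seteqP; split=> x /=; rewrite nrmE lecR.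
by rewrite precompact_totally_bounded.
Qed.

Lemma ball_bound (V W : normedModType C) (T : V -> W) (e : R) : linear T ->
  (forall v, nrm v <= 1 -> nrm (T v) <= e) -> forall v, nrm (T v) <= e * nrm v.
Proof.
move=> lT Te v; have [->|v0] := eqVneq v 0.
  by rewrite (linear_fun0 lT) !nrm0 mulr0.
have n0 := nrm_gt0 v0; rewrite -ler_pdivrMr//.
have := Te ((nrm v)^-1%:C *: v); rewrite (linear_funZ _ _ lT) !nrmZ.
rewrite nrm_real ?invr_ge0 ?nrm_ge0// mulVf ?gt_eqF// mulrC; exact.
Qed.

Lemma tb_comp (V W U : normedModType C) (T : W -> U) (S : V -> W) :
  linear T -> tb_operator T -> bounded_linear S -> tb_operator (T \o S).
Proof.
move=> lT tT [lS [M [M0 HM]]] e e0.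
have D0 : 0 < M + 1 by rewrite ltr_wpDl.
have [s Hs] := tT _ (divr_gt0 e0 D0).
exists [seq (M + 1)%:C *: p | p <- s] => _ [v /= v1 <-].
have [|p ps vp] := Hs (T (((M + 1)^-1)%:C *: S v)).
  exists (((M + 1)^-1)%:C *: S v) => //=.
  rewrite /unit_ball/= nrmZ nrm_real ?invr_ge0 ?(ltW D0)// mulrC ler_pdivrMr//.
  rewrite mul1r; have := HM v; have := ler_wpM2l M0 v1; lra.
exists ((M + 1)%:C *: p); first exact: map_f.
have -> : T (S v) = (M + 1)%:C *: T (((M + 1)^-1)%:C *: S v).
  by rewrite -(linear_funZ _ _ lT) scalerA -rmorphM/= divff ?gt_eqF// scale1r.
rewrite -scalerBr nrmZ nrm_real ?(ltW D0)// mulrC -ltr_pdivlMr//.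
Qed.

(** Meant for T the product of the adjoint of S with S. On the unit ball |S v - S w|^2 <= 2 |T v - T
    w|, so a net for T yields one for S once its centres are moved to images of ball vectors. *)
Lemma tb_dominated (V W U : normedModType C) (S : V -> W) (T : V -> U) :
  linear S -> linear T -> tb_operator T ->
  (forall v, nrm (S v) ^+ 2 <= nrm v * nrm (T v)) -> tb_operator S.
Proof.
move=> lS lT tT ST e e0; pose d := e ^+ 2 / 8.
have d0 : 0 < d by rewrite divr_gt0 ?exprn_gt0.
have [s Hs] := tT _ d0.
(* A ball vector whose image is near p; 0 is a default for useless centres. *)
have Hg p : exists v, (exists2 w, nrm w <= 1 & nrm (T w - p) < d) ->
    nrm v <= 1 /\ nrm (T v - p) < d.
  have [[w w1 wp]|h] := pselect (exists2 w, nrm w <= 1 & nrm (T w - p) < d).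
    by exists w.
  by exists 0 => /h.
pose g p := projT1 (cid (Hg p)).
exists [seq S (g p) | p <- s] => _ [v /= v1 <-].
have [|p ps vp] := Hs (T v); first by exists v.
exists (S (g p)); first by apply/mapP; exists p.
have [|g1 gp] := projT2 (cid (Hg p)); first by exists v.
rewrite -/(g p) in g1 gp.
rewrite -ltr_sqr ?nnegrE ?nrm_ge0 ?(ltW e0)// -(linear_funB _ _ lS).
apply: le_lt_trans (ST _) _; rewrite (linear_funB _ _ lT).
have h1 := nrm_dist p (T v) (T (g p)); rewrite (nrmB p) in h1.
have h2 := nrmB_le v (g p); rewrite /unit_ball/= in v1.
apply: (@le_lt_trans _ _ (2 * (d + d))).
  by apply: ler_pM; rewrite ?nrm_ge0//; lra.
have := exprn_gt0 2 e0; rewrite /d; lra.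
Qed.

Lemma tb_limit (V W : normedModType C) (T : V -> W) :
  (forall e : R, 0 < e -> exists T' : V -> W, tb_operator T' /\
     forall v, nrm (T v - T' v) <= e * nrm v) -> tb_operator T.
Proof.
move=> HT e e0; have e20 : 0 < e / 2 by rewrite divr_gt0.
have [T' [tT' TT']] := HT _ e20; have [s Hs] := tT' _ e20.
exists s => _ [v /= v1 <-]; have [|p ps vp] := Hs (T' v); first by exists v.
exists p => //; apply: le_lt_trans (nrm_dist (T' v) _ _) _.
rewrite (splitr e); apply: ler_ltD => //; apply: le_trans (TT' v) _.
by rewrite ler_piMr// ltW.
Qed.

Lemma tb_linear (V W : normedModType C) (S T : V -> W) (c : C) :
  tb_operator S -> tb_operator T -> tb_operator (fun v => c *: S v + T v).
Proof.
move=> tS tT e e0; have D0 : 0 < nrm c + 1 by rewrite ltr_wpDl ?nrm_ge0.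
have d0 := divr_gt0 e0 D0; have [s Hs] := tS _ d0; have [t Ht] := tT _ d0.
exists [seq c *: p + q | p <- s, q <- t] => _ [v /= v1 <-].
have [|p ps vp] := Hs (S v); first by exists v.
have [|q qt vq] := Ht (T v); first by exists v.
exists (c *: p + q); first by apply/allpairsP; exists (p, q).
rewrite opprD addrACA -scalerBr; apply: le_lt_trans (nrmD_le _ _) _.
rewrite nrmZ; set d := e / _ in vp vq.
have <- : d * (nrm c + 1) = e by rewrite divfK// gt_eqF.
have := ler_wpM2l (nrm_ge0 c) (ltW vp); lra.
Qed.

Lemma tb_const0 (V W : normedModType C) : tb_operator (fun _ : V => 0 : W).
Proof.
by move=> e e0; exists [:: 0] => _ [v _ <-]; exists 0; rewrite ?inE// subrr nrm0.
Qed.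

Lemma tb_bounded (V W : normedModType C) (T : V -> W) : linear T ->
  tb_operator T -> bounded_linear T.
Proof.
move=> lT tT; split=> //; have [s Hs] := tT 1 ltr01.
have [M [M0 HM]] : exists M : R, 0 <= M /\ forall p, p \in s -> nrm p <= M.
  elim: s {Hs} => [|p s [M [M0 HM]]]; first by exists 0.
  exists (nrm p + M); split; first by rewrite addr_ge0 ?nrm_ge0.
  move=> q; rewrite inE => /orP[/eqP->|/HM]; first by rewrite lerDl.
  by move/le_trans; apply; rewrite lerDr nrm_ge0.
exists (M + 1); split; first by rewrite addr_ge0.
apply: ball_bound => // v v1; have [|p ps vp] := Hs (T v); first by exists v.
rewrite -[T v](subrK p); apply: le_trans (nrmD_le _ _) _.
by rewrite addrC lerD ?HM ?ltW.
Qed.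

Lemma real_grid (M e : R) : 0 < e -> exists s : seq R,
  forall x, `|x| <= M -> exists2 p, p \in s & `|x - p| <= e.
Proof.
move=> e0; exists [seq i%:R * e - M | i <- iota 0 (Num.trunc ((M + M) / e)).+1] => x.
rewrite ler_norml => /andP[x1 x2]; pose i := Num.trunc ((x + M) / e).
have y0 : 0 <= (x + M) / e by rewrite divr_ge0 ?(ltW e0)//; lra.
have /andP[i1 i2] := truncn_itv y0; exists (i%:R * e - M).
  apply/mapP; exists i => //; rewrite mem_iota/= ltnS.
  by apply: le_truncn; rewrite ler_pM2r ?invr_gt0//; lra.
rewrite -/i ler_pdivlMr// in i1; rewrite -/i ltr_pdivrMr// -natr1 in i2.
by rewrite ler_norml; apply/andP; split; lra.
Qed.

Lemma tb_rank1 (V W : normedModType C) (f : V -> C) (w : W) (M : R) :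
  (forall v, nrm (f v) <= M * nrm v) -> tb_operator (fun v => f v *: w).
Proof.
move=> fM e e0; pose M' := `|M|.
have D0 : 0 < 2 * nrm w + 1 by rewrite ltr_wpDl ?mulr_ge0 ?nrm_ge0.
have d0 := divr_gt0 e0 D0; set d := e / _ in d0.
have dE : d * (2 * nrm w + 1) = e by rewrite divfK// gt_eqF.
have [s Hs] := real_grid M' d0.
exists [seq (a +i* b) *: w | a <- s, b <- s] => _ [v /= v1 <-].
have fv : nrm (f v) <= M'.
  apply: le_trans (fM v) _; apply: (@le_trans _ _ (M' * nrm v)).
    by rewrite ler_wpM2r ?nrm_ge0// ler_norm.
  by rewrite ler_piMr// normr_ge0.
have [a as_ Ha] := Hs _ (le_trans (Re_nrm _) fv).
have [b bs Hb] := Hs _ (le_trans (Im_nrm _) fv).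
exists ((a +i* b) *: w); first by apply/allpairsP; exists (a, b).
rewrite -scalerBl nrmZ; apply: (@le_lt_trans _ _ ((d + d) * nrm w)).
  rewrite ler_wpM2r ?nrm_ge0//; apply: le_trans (nrm_le_ReIm _) _.
  by rewrite !raddfB lerD.
lra.
Qed.

End TotallyBoundedOperators.

(** * Approximate Riesz representation *)

Section RieszApproximation.
Variables (R : realType) (H : hilbertSpace R).
Local Notation C := R[i].

Let hsip := @hdot_semi_ip R H.

Lemma Re_realM (r : R) (z : C) : complex.Re (r%:C * z) = r * complex.Re z.
Proof. by case: z => a b /=; rewrite mul0r subr0. Qed.

Lemma hnrm_sqrD (x y : H) :
  nrm (x + y) ^+ 2 = nrm x ^+ 2 + nrm y ^+ 2 + 2 * complex.Re (hdot x y).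
Proof.
have reJ (z : C) : complex.Re (z^*)%C = complex.Re z by case: z.
have -> : nrm (x + y) ^+ 2 = complex.Re (hdot (x + y) (x + y)) by rewrite hdot_nrm.
rewrite (sipDl hsip) !(sipDr hsip) !hdot_nrm (sipC hsip x y) !raddfD/= reJ.
by ring.
Qed.

Lemma nrm_sqrD (z w : C) :
  nrm (z + w) ^+ 2 = nrm z ^+ 2 + nrm w ^+ 2 + 2 * complex.Re (z * (w^*)%C).
Proof.
have reJ (u : C) : complex.Re (u^*)%C = complex.Re u by case: u.
have nE (u : C) : nrm u ^+ 2 = complex.Re (u * (u^*)%C) by rewrite -nrm_sqr.
rewrite !nE conjcD mulrDl !mulrDr !raddfD/=.
have -> : complex.Re (w * (z^*)%C) = complex.Re (z * (w^*)%C).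
  by rewrite -reJ conjcM conjcK mulrC.
by ring.
Qed.

Lemma ball_bound_scalar (g : H -> C) (e : R) :
  (forall c x, g (c *: x) = c * g x) ->
  (forall x, nrm x <= 1 -> nrm (g x) <= e) -> forall x, nrm (g x) <= e * nrm x.
Proof.
move=> gZ ge x; have [->|x0] := eqVneq x 0.
  by rewrite -[X in g X](scale0r (0 : H)) gZ mul0r !nrm0 mulr0.
have n0 := nrm_gt0 x0; rewrite -ler_pdivrMr//.
have := ge ((nrm x)^-1%:C *: x); rewrite gZ nrmM nrmZ.
by rewrite nrm_real ?invr_ge0 ?nrm_ge0// mulVf ?gt_eqF// mulrC; apply.
Qed.

(* If |f z0| is close to the norm m of f, comparing |f|^2 with m^2 |.|^2 near z0
   shows that the derivatives of these two functions at z0 are close. *)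
Lemma riesz_approximation (f : H -> C) (M : R) :
  (forall c x y, f (c *: x + y) = c * f x + f y) -> 0 <= M ->
  (forall x, nrm (f x) <= M * nrm x) ->
  forall e : R, 0 < e -> exists w, forall x, nrm (f x - hdot x w) <= e * nrm x.
Proof.
move=> flin M0 fM e e0.
pose D := [set r : R | exists2 x, nrm x <= 1 & r = nrm (f x)].
have f0 : f 0 = 0.
  by have := flin (-1) 0 0; rewrite scaler0 addr0 mulN1r addNr.
have fZ c x : f (c *: x) = c * f x by have := flin c x 0; rewrite f0 !addr0.
have D_sup : has_sup D.
  split; first by exists (nrm (f 0)); exists 0 => //; rewrite nrm0.
  exists M => _ [x x1 ->]; apply: le_trans (fM x) _.
  by rewrite ler_piMr.
pose m := sup D.
have mD x : nrm x <= 1 -> nrm (f x) <= m.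
  by move=> x1; apply: sup_upper_bound => //; exists x.
have m0 : 0 <= m by apply: le_trans (nrm_ge0 _) (mD 0 _); rewrite nrm0.
have fm : forall x, nrm (f x) <= m * nrm x by apply: ball_bound_scalar.
have [me|em] := leP m e.
  exists 0 => x; rewrite (sip0r hsip) subr0; apply: le_trans (fm x) _.
  by rewrite ler_wpM2r ?nrm_ge0.
have m_gt0 : 0 < m by apply: lt_trans em.
(* Chosen for the end: m^2 - |a|^2 <= 2 m d and m^2 <= 4 |a|^2 bound the square of the error by 8 m
   d = e^2. *)
pose d := e ^+ 2 / (8 * m).
have d0 : 0 < d by rewrite divr_gt0 ?exprn_gt0 ?mulr_gt0.
have dm : d * (8 * m) = e ^+ 2 by rewrite divfK// gt_eqF ?mulr_gt0.
have dm8 : 8 * d <= m.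
  rewrite -(ler_pM2r m_gt0); have -> : 8 * d * m = e ^+ 2 by rewrite -dm; ring.
  by rewrite -expr2 ler_sqr ?nnegrE ?(ltW e0)// ltW.
have [_ [z z1 ->] az] := sup_adherent d0 D_sup; rewrite -/m in az.
set a := f z in az; have am : nrm a <= m := mD z z1.
pose w0 x := (a^*)%C * f x - (m ^+ 2)%:C * hdot x z.
have key x : nrm x <= 1 -> nrm (w0 x) ^+ 2 <= m ^+ 2 * (m ^+ 2 - nrm a ^+ 2).
  move=> x1; set w := w0 x; pose t := (m ^+ 2)^-1.
  have m2 : 0 < m ^+ 2 by rewrite exprn_gt0.
  have tm : t * m ^+ 2 = 1 by rewrite mulVf// gt_eqF.
  (* Moving z by c x gains 2 t W at first order and costs at most t W at second order, where W =
     |w|^2; so t W is at most m^2 - |a|^2. *)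
  pose c := t%:C * (w^*)%C.
  have h1 : nrm (f (c *: x + z)) ^+ 2 <= m ^+ 2 * nrm (c *: x + z) ^+ 2.
    by rewrite -exprMn ler_sqr ?nnegrE ?mulr_ge0 ?nrm_ge0.
  have nz2 : nrm z ^+ 2 <= 1 by rewrite expr_le1 ?nrm_ge0.
  have nx2 : nrm x ^+ 2 <= 1 by rewrite expr_le1 ?nrm_ge0.
  set W := nrm w ^+ 2.
  have W0 : 0 <= W by rewrite sqr_ge0.
  have cn : nrm c ^+ 2 = t ^+ 2 * W.
    by rewrite nrmM exprMn nrm_conj nrm_real// invr_ge0 ltW.
  have e1 : complex.Re (c * f x * (a^*)%C) - m ^+ 2 * complex.Re (c * hdot x z) = t * W.
    rewrite -Re_realM -raddfB/=.
    have -> : c * f x * (a^*)%C - (m ^+ 2)%:C * (c * hdot x z) = c * w.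
      by rewrite /w /w0; ring.
    by rewrite /c -mulrA [_ * w]mulrC -nrm_sqr -rmorphM.
  rewrite flin nrm_sqrD hnrm_sqrD nrmM nrmZ !exprMn cn -/a in h1.
  rewrite (sipZl hsip) in h1.
  have h2 : m ^+ 2 * (t ^+ 2 * W * nrm x ^+ 2) <= t * W.
    have -> : m ^+ 2 * (t ^+ 2 * W * nrm x ^+ 2) = (t * m ^+ 2) * (t * W * nrm x ^+ 2).
      by ring.
    by rewrite tm mul1r ler_piMr// mulr_ge0// invr_ge0 ltW.
  have h3 : m ^+ 2 * nrm z ^+ 2 <= m ^+ 2 by rewrite ler_piMr// ltW.
  have h4 : 0 <= t ^+ 2 * W * nrm (f x) ^+ 2.
    by rewrite mulr_ge0 ?sqr_ge0// mulr_ge0 ?sqr_ge0.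
  have h5 : t * W <= m ^+ 2 - nrm a ^+ 2.
    move: h1 e1 h2 h3 h4; move: (t * W) (t ^+ 2 * W * _) (t ^+ 2 * W * _).
    move: (complex.Re _) (complex.Re _) (m ^+ 2) (nrm a ^+ 2) (nrm z ^+ 2) => *.
    lra.
  have := ler_wpM2l (ltW m2) h5; rewrite mulrA [m ^+ 2 * t]mulrC tm mul1r.
  by [].
have a2 : m / 2 <= nrm a by lra.
have a_gt0 : 0 < nrm a by apply: lt_le_trans a2; rewrite divr_gt0.
(* The vector obtained by solving [w0 x = 0] for f(x). *)
exists (((m ^+ 2)%:C / a) *: z); apply: ball_bound_scalar.
- by move=> c x; rewrite (sipZl hsip) fZ mulrBr.
move=> x x1; rewrite (sipZr hsip).
have a0 : (a^*)%C != 0 by rewrite conjc_eq0; apply: contraTneq a_gt0 => ->; rewrite nrm0 ltxx.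
have -> : f x - (((m ^+ 2)%:C / a)^*)%C * hdot x z = ((a^*)%C)^-1 * w0 x.
  rewrite /w0 conjcM conjc_real conjc_inv mulrBr mulrA mulVf// mul1r; ring.
rewrite nrmM.
have -> : nrm ((a^*)%C)^-1 = (nrm a)^-1.
  apply: (mulIf (x := nrm a)); first by rewrite gt_eqF.
  by rewrite mulVf ?gt_eqF// -(nrm_conj a) -nrmM mulVf// /nrm normr1.
rewrite ler_pdivrMl// -ler_sqr ?nnegrE ?mulr_ge0 ?nrm_ge0 ?(ltW e0)//.
apply: le_trans (key x x1) _.
have h1 : m ^+ 2 - nrm a ^+ 2 <= 2 * m * d.
  have : m - d <= nrm a by exact: ltW.
  have : 0 <= nrm a by exact: ltW.
  by move: (nrm a) am m0 dm8 d0 => n *; nra.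
have h2 : m ^+ 2 <= 4 * nrm a ^+ 2.
  by move: (nrm a) a2 m0 => n *; nra.
have : m ^+ 2 * (m ^+ 2 - nrm a ^+ 2) <= 4 * nrm a ^+ 2 * (2 * m * d).
  apply: ler_pM => //; first exact: sqr_ge0.
  by rewrite subr_ge0 ler_sqr ?nnegrE// ltW.
have -> : 4 * nrm a ^+ 2 * (2 * m * d) = nrm a ^+ 2 * (d * (8 * m)) by ring.
by rewrite dm exprMn.
Qed.

End RieszApproximation.

(** * Finite rank operators in the range of an irreducible representation *)

Section CompactRange.
Variables (R : realType) (A : cstarAlgebra R) (H : hilbertSpace R).
Variable pi : {bilinear A -> H -> H}.
Hypothesis ipi : is_irreducible pi.
Local Notation C := R[i].
Local Notation "a ∗ b" := (cmul a b) (at level 40, left associativity).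

Let hpi := irr_representation ipi.
Let hsip := @hdot_semi_ip R H.

Definition in_range (T : H -> H) := exists a, forall x, T x = pi a x.

(** Multiplying by pi(c) on the left and pi([cstar b]) on the right turns the pair (y, y) into
    (pi(b) y, pi(c) y), and y is cyclic. *)
Lemma rank1_in_range (y : H) : y != 0 -> in_range (fun x => hdot x y *: y) ->
  forall p q, in_range (fun x => hdot x p *: q).
Proof.
move=> y0 [a Ha] p q; apply: rep_closed_range => // e e0.
have D0 : 0 < nrm p + nrm q + 1 by rewrite ltr_wpDl ?addr_ge0 ?nrm_ge0.
(* The cap at 1 absorbs the term quadratic in d. *)
pose d := Num.min 1 (e / (nrm p + nrm q + 1)).
have d0 : 0 < d by rewrite lt_min ltr01 divr_gt0.
have d1 : d <= 1 by rewrite ge_min lexx.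
have de : d * (nrm p + nrm q + 1) <= e by rewrite -ler_pdivlMr// ge_min lexx orbT.
have [b pb] := irr_cyclic ipi y0 p d0; have [c qc] := irr_cyclic ipi y0 q d0.
exists (c ∗ (a ∗ cstar b)) => x.
rewrite !(rep_mul hpi) -Ha (linear_funZ _ _ (rep_linear pi c)).
rewrite (rep_star hpi) cstarK.
have -> : hdot x p *: q - hdot x (pi b y) *: pi c y =
    hdot x (p - pi b y) *: q + hdot x (pi b y) *: (q - pi c y).
  by rewrite (sipBr hsip) scalerBl scalerBr addrA subrK.
apply: le_trans (nrmD_le _ _) _; rewrite !nrmZ.
have h1 := hdot_cauchy_schwarz x (p - pi b y).
have h2 := hdot_cauchy_schwarz x (pi b y).
have h3 : nrm (pi b y) <= nrm p + d.
  by rewrite -[pi b y](subKr p); apply: le_trans (nrmB_le _ _) _; rewrite lerD2l.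
have x0 := nrm_ge0 x; have q0 := nrm_ge0 q; have p0 := nrm_ge0 p.
have h4 : nrm (hdot x (p - pi b y)) * nrm q <= nrm x * d * nrm q.
  by rewrite ler_wpM2r//; apply: le_trans h1 _; rewrite ler_wpM2l.
have h5 : nrm (hdot x (pi b y)) * nrm (q - pi c y) <= nrm x * (nrm p + d) * d.
  apply: ler_pM; rewrite ?nrm_ge0//; apply: le_trans h2 _; rewrite ler_wpM2l//.
have h6 : nrm x * d * nrm q + nrm x * (nrm p + d) * d <= nrm x * e.
  have -> : nrm x * d * nrm q + nrm x * (nrm p + d) * d =
     nrm x * (d * (nrm p + nrm q + d)) by ring.
  rewrite ler_wpM2l//; apply: le_trans de; rewrite ler_wpM2l ?(ltW d0)//; lra.
rewrite mulrC in h6; lra.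
Qed.

Hypothesis rank1 : forall p q, in_range (fun x => hdot x p *: q).

(** The operator pairs x with the adjoint of T at p; that vector is replaced by approximate Riesz
    vectors, and the closed range absorbs the error. *)
Lemma rank1_comp_in_range (T : H -> H) (p q : H) : bounded_linear T ->
  in_range (fun x => hdot (T x) p *: q).
Proof.
move=> [lT [M [M0 HM]]]; apply: rep_closed_range => // e e0.
have D0 : 0 < nrm q + 1 by rewrite ltr_wpDl ?nrm_ge0.
have [||x|w Hw] := @riesz_approximation R H (fun x => hdot (T x) p) (M * nrm p) _ _ _
    (e / (nrm q + 1)) (divr_gt0 e0 D0).
- by move=> c x y; rewrite lT (sip_linear hsip).
- by rewrite mulr_ge0 ?nrm_ge0.
- apply: le_trans (hdot_cauchy_schwarz _ _) _; rewrite mulrAC.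
  by rewrite ler_wpM2r ?nrm_ge0.
have [a Ha] := rank1 w q; exists a => x; rewrite -Ha -scalerBl nrmZ.
have x0 := nrm_ge0 x; have q0 := nrm_ge0 q.
apply: le_trans (ler_wpM2r q0 (Hw x)) _; set d := e / _.
have -> : e = d * (nrm q + 1) by rewrite divfK// gt_eqF.
have d0 : 0 <= d by rewrite divr_ge0 ?ltW.
have : 0 <= d * nrm x by rewrite mulr_ge0.
lra.
Qed.

(* Gram-Schmidt: P is the orthogonal projection onto the span of s. *)
Lemma finite_projection (s : seq H) : exists P : H -> H,
  [/\ linear P, forall x y, hdot (P x) y = hdot x (P y),
      forall x, P (P x) = P x, forall p, p \in s -> P p = p &
      forall T, bounded_linear T -> in_range (P \o T)].
Proof.
elim: s => [|p s [P [lP sP PP Ps PT]]].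
  exists (fun=> 0); split=> //.
  - by move=> c x y; rewrite scaler0 addr0.
  - by move=> x y; rewrite (sip0l hsip) (sip0r hsip).
  - by move=> T _; exists 0 => x /=; rewrite linear0l.
pose q := p - P p; have Pq : P q = 0 by rewrite (linear_funB _ _ lP) PP subrr.
have pE : p = q + P p by rewrite subrK.
clearbody q; have [q0|q0] := eqVneq q 0.
  exists P; split=> // r; rewrite inE => /orP[/eqP->|/Ps//].
  by rewrite [RHS]pE q0 add0r.
pose n2 : C := (nrm q ^+ 2)%:C.
have n20 : n2 != 0.
  by rewrite /n2 rmorphXn/= expf_eq0/=; apply: contra q0 => /eqP/complexI/nrm_eq0->.
have n2c : (n2^*)%C = n2 by rewrite conjc_real.
pose P' x := P x + (hdot x q / n2) *: q.
have qq : hdot q q = n2 by rewrite hdot_nrm.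
have P'q : P' q = q by rewrite /P' Pq add0r qq divff// scale1r.
have Pxq x : hdot (P x) q = 0 by rewrite sP Pq (sip0r hsip).
have lP' : linear P'.
  move=> c x y; rewrite /P' lP (sip_linear hsip) mulrDl scalerDl scalerDr scalerA.
  by rewrite mulrA addrACA.
exists P'; split=> //.
- move=> x y; rewrite /P' (sipDl hsip) (sipDr hsip) sP (sipZl hsip) (sipZr hsip).
  rewrite conjcM conjc_inv n2c -(sipC hsip); congr (_ + _); ring.
- move=> x; rewrite [P' x in LHS]/P' (linear_funD _ _ lP') (linear_funZ _ _ lP') P'q.
  by rewrite {1}/P' PP Pxq mul0r scale0r addr0.
- move=> r; rewrite inE => /orP[/eqP->|/Ps Pr].
    rewrite [in LHS]pE (linear_funD _ _ lP') P'q.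
    by rewrite /P' PP Pxq mul0r scale0r addr0 -pE.
  by rewrite /P' Pr -Pr Pxq mul0r scale0r addr0.
(* Passing from P T to P' T adds one rank one operator composed with T. *)
move=> T bT; have [a Ha] := PT T bT.
have [b Hb] := @rank1_comp_in_range T q (n2^-1 *: q) bT.
exists (a + b) => x; rewrite repD -Ha -Hb /P' /= scalerA; congr (_ + _ *: _).
Qed.

End CompactRange.

Section CompactOperators.
Variables (R : realType) (A : cstarAlgebra R) (H : hilbertSpace R).
Variable pi : {bilinear A -> H -> H}.
Hypothesis ipi : is_irreducible pi.
Local Notation C := R[i].

Let hpi := irr_representation ipi.
Let hsip := @hdot_semi_ip R H.

(** P projects onto the span of a finite e-net of the image of the ball. Since P fixes each p of the
    net, T x - P T x = (1 - P)(T x - p), of norm less than e. *)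
Lemma compact_in_range (y : H) (T : H -> H) :
  y != 0 -> in_range pi (fun x => hdot x y *: y) ->
  linear T -> tb_operator T -> in_range pi T.
Proof.
move=> y0 ry lT tT; have bT := tb_bounded lT tT.
apply: rep_closed_range => // e e0; have [s Hs] := tT _ e0.
have [P [lP sP PP Ps PT]] := finite_projection ipi (rank1_in_range ipi y0 ry) s.
have [a Ha] := PT T bT; exists a => x; rewrite -Ha; move: x.
have lTP : linear (fun x => T x - P (T x)).
  by move=> c x z; rewrite lT lP opprD addrACA -scalerBr.
have contr z : nrm (z - P z) <= nrm z.
  have [->|z0] := eqVneq (z - P z) 0; first by rewrite nrm0 nrm_ge0.
  have n0 := nrm_gt0 z0; rewrite -(ler_pM2r n0) -expr2 -[leLHS]nrm_real ?sqr_ge0//.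
  rewrite -hdot_nrm; have -> : hdot (z - P z) (z - P z) = hdot z (z - P z).
    rewrite (sipBl hsip) [hdot (P z) _]sP (linear_funB _ _ lP) PP subrr.
    by rewrite (sip0r hsip) subr0.
  exact: hdot_cauchy_schwarz.
apply: (ball_bound lTP) => x x1 /=; have [|p ps xp] := Hs (T x); first by exists x.
have -> : T x - P (T x) = (T x - p) - P (T x - p).
  by rewrite (linear_funB _ _ lP) (Ps p ps) opprB [RHS]addrA subrK.
exact: le_trans (contr _) (ltW xp).
Qed.

End CompactOperators.

(** * Transfer of liminarity *)

Section MoritaLiminary.
Variables (R : realType) (A B : cstarAlgebra R) (X : lmodType R[i]).
Variables (la : A -> X -> X) (ra : X -> B -> X).
Variables (lip : X -> X -> A) (rip : X -> X -> B).
Hypothesis mo : morita_context la ra lip rip.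
Local Notation C := R[i].

Theorem morita_liminary : liminary A -> liminary B.
Proof.
move=> limA H pi ipi; have hpi := irr_representation ipi.
have hsipH := @hdot_semi_ip R H.
have [b0 [x0 bx0]] := irr_nonzero ipi.
set xi := pi b0 x0 in bx0.
have [K [sg [F [T [isg [bFT [FT [FTsg TFpi sgF]]]]]]]] := morita_induction mo ipi bx0.
have hsipK := @hdot_semi_ip R K; have bF x := (bFT x).1; have bT x := (bFT x).2.
have sgE a : linear (sg a : K -> K) /\ tb_operator (sg a : K -> K).
  by apply/compact_operatorsE; rewrite -(limA _ _ isg); exists a.
(* Domination: |T_x k|^2 = <F_x T_x k, k>, and F_x T_x is compact. *)
have tbT x : tb_operator (T x).
  apply: (tb_dominated (bT x).1 (sgE (lip x x)).1 (sgE (lip x x)).2) => k.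
  rewrite -[leLHS]nrm_real ?sqr_ge0// -hdot_nrm -FT FTsg.
  by rewrite (sipC hsipK) nrm_conj; exact: hdot_cauchy_schwarz.
have tb_pi b : tb_operator (pi b).
  move: b; apply: (mo_full mo (S := [set b | tb_operator (pi b)])) => /=.
  - have -> : pi 0 = (fun=> 0) :> (H -> H) by apply/funext => x; rewrite linear0l.
    exact: tb_const0.
  - move=> c a b ta tb.
    have -> : pi (c *: a + b) = (fun x => c *: pi a x + pi b x) :> (H -> H).
      by apply/funext => x; rewrite repD repZ.
    exact: tb_linear.
  - move=> b Hb; apply: tb_limit => e e0.
    have e20 : 0 < e / 2 by rewrite divr_gt0.
    have [b' tb' bb'] := Hb _ e20; exists (pi b'); split=> // x.
    rewrite -repB; apply: le_trans (rep_bound hpi _ _) _.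
    by rewrite ler_wpM2r ?nrm_ge0//; lra.
  move=> x y; have -> : pi (rip x y) = T x \o F y :> (H -> H).
    by apply/funext => z /=; rewrite TFpi.
  exact: tb_comp (bT x).1 (tbT x) (bF y).
have [x [k Txk]] : exists x k, T x k != 0.
  apply: contrapT => h.
  have T0 x k : T x k = 0 by apply: contrapT => /eqP Tk; apply: h; exists x, k.
  have pi0 b : forall z, pi b z = 0.
    move: b; apply: (mo_full mo (S := [set b | forall z, pi b z = 0])) => /=.
    - by move=> z; rewrite linear0l.
    - by move=> c a b ha hb z; rewrite repD repZ ha hb scaler0 addr0.
    - apply: limit_closed_forall => z; apply: limit_closed_preimage (@limit_closed0 _ _) _.
      exact: (lipschitz_rep ipi).
    by move=> x y z; rewrite -TFpi T0.
  by move/eqP: bx0; apply; rewrite /xi pi0.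
have [a _ Ha] : range (fun a => sg a : K -> K) (fun l => hdot l k *: k).
  rewrite (limA _ _ isg); apply/compact_operatorsE; split.
    by move=> c l l'; rewrite (sip_linear hsipK) scalerDl scalerA.
  apply: (@tb_rank1 R K K (fun l => hdot l k) k (nrm k)) => l.
  by rewrite mulrC; exact: hdot_cauchy_schwarz.
(* Conjugating the rank one operator of k gives the one of T_x k, by adjunction. *)
have ry : in_range pi (fun z => hdot z (T x k) *: T x k).
  exists (rip x (la a x)) => z; rewrite -TFpi -sgF.
  have -> : sg a (F x z) = hdot (F x z) k *: k.
    by have /= := congr1 (fun f => f (F x z)) Ha.
  by rewrite (linear_funZ _ _ (bT x).1) FT.
apply/seteqP; split=> [_ [b _ <-]|S /compact_operatorsE[lS tS]].
  by apply/compact_operatorsE; split=> //; exact: rep_linear.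
have [b Hb] := compact_in_range ipi Txk ry lS tS.
by exists b => //; apply/funext => z; rewrite Hb.
Qed.

End MoritaLiminary.

(** * Imprimitivity bimodules *)

Section ConjugateModule.
Variables (R : realType) (V : lmodType R[i]).
Local Notation C := R[i].

(** A synonym, so that the conjugate scalar action does not clash with the original one. *)
Definition conj_module : Type := V.

HB.instance Definition _ := GRing.Zmodule.on conj_module.

Definition conj_scale (c : C) (v : conj_module) : conj_module :=
  ((c^*)%C *: (v : V) : V).

Fact conj_scaleA a b v : conj_scale a (conj_scale b v) = conj_scale (a * b) v.
Proof. by rewrite /conj_scale scalerA conjcM. Qed.
Fact conj_scale1 : left_id 1 conj_scale.
Proof. by move=> v; rewrite /conj_scale conjc1 scale1r. Qed.
Fact conj_scaleDr : right_distributive conj_scale +%R.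
Proof. by move=> a u v; rewrite /conj_scale scalerDr. Qed.
Fact conj_scaleDl v : {morph conj_scale^~ v : a b / a + b}.
Proof. by move=> a b; rewrite /conj_scale conjcD scalerDl. Qed.

HB.instance Definition _ := GRing.Zmodule_isLmodule.Build C conj_module
  conj_scaleA conj_scale1 conj_scaleDr conj_scaleDl.

End ConjugateModule.

Section ImprimitivityBimodule.
Variables (R : realType) (A B : cstarAlgebra R) (X : imprimitivityBimodule A B).
Local Notation C := R[i].
Local Notation "a ∗ b" := (cmul a b) (at level 40, left associativity).
Local Notation la := (@lact R A B X).
Local Notation ra := (@ract R A B X).
Local Notation lp := (@lip R A B X).
Local Notation rp := (@rip R A B X).

Let hl := ib_left X.
Let hr := ib_right X.

(* The adjoint S of the action of a is the action of cstar a, since both agree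
   after applying any of the operators z |-> v <u, z>. *)
Lemma rip_lact a x y : rp (la a x) y = rp x (la (cstar a) y).
Proof.
have [S HS] := @ib_lact_adjointable R A B X a; rewrite HS; congr (rp x _).
apply/esym/eqP; rewrite -subr_eq0; set w := _ - _; apply/eqP.
have w0 u v : ra v (rp u w) = 0.
  rewrite -ib_ipA /w linearBr/= -(lh_actA hl).
  have -> : lp v u ∗ cstar a = lp v (la a u).
    by rewrite -(lh_ip_star hl u v) -cstarM -(lh_ip_act hl) (lh_ip_star hl).
  by rewrite !ib_ipA HS subrr.
(* The square of <w, w>_B is <w, w <w, w>_B>_B, which vanishes by [w0]. *)
apply: (rh_ip_eq0 hr); apply: cmul_eq0_selfadjoint; first exact: rh_ip_star hr _ _.
by rewrite -(rh_ip_act hr) w0 linear0r.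
Qed.

(** Mirror image of [rip_lact]: here w is tested by the operators v |-> <w, u>_A v. *)
Lemma lip_ract b x y : lp (ra x b) y = lp x (ra y (cstar b)).
Proof.
have [S HS] := @ib_ract_adjointable R A B X b; rewrite HS; congr (lp x _).
apply/esym/eqP; rewrite -subr_eq0; set w := _ - _; apply/eqP.
have w0 u v : la (lp w u) v = 0.
  rewrite ib_ipA /w linearBl -(rh_actA hr).
  have -> : cstar b ∗ rp u v = rp (ra u b) v.
    by rewrite -(rh_ip_star hr v u) -cstarM -(rh_ip_act hr) (rh_ip_star hr).
  by rewrite -!ib_ipA -(lh_ip_star hl (ra u b)) HS (lh_ip_star hl) subrr.
apply: (lh_ip_eq0 hl); apply: cmul_eq0_selfadjoint; first exact: lh_ip_star hl _ _.
by rewrite -(lh_ip_act hl) w0 linear0l.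
Qed.

Lemma dense_span_ind (D : cstarAlgebra R) (G S : set D) :
  closure (linear_span G) = setT -> S 0 ->
  (forall c a b, S a -> S b -> S (c *: a + b)) -> limit_closed S ->
  (forall a, G a -> S a) -> forall a, S a.
Proof.
move=> clG S0 Slin Scl GS a; apply: Scl => e e0.
have /closure_nrm/(_ e e0)[b [n [c [u [uG ->]]]] ab] : closure (linear_span G) a.
  by rewrite clG.
exists (\sum_(i < n) c i *: u i) => //; elim/big_rec: _ => // i b' _ Sb'.
by apply: Slin => //; apply: GS.
Qed.

Lemma bimodule_morita_context : morita_context la ra lp rp.
Proof.
split.
- by move=> c a b x; rewrite linearPl.
- by move=> c a x y; rewrite linearPr.
- exact: lh_actA hl.
- by move=> c x a b; rewrite linearPr.
- exact: rh_actA hr.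
- exact: ib_actA.
- by move=> c x y z; rewrite linearPr.
- exact: rh_ip_star hr.
- exact: rh_ip_act hr.
- exact: rh_ip_ge0 hr.
- exact: rip_lact.
- exact: ib_ipA.
move=> S S0 Slin Scl Srp; apply: dense_span_ind (rh_full hr) S0 Slin Scl _.
by move=> _ [z _ <-].
Qed.

(** On the conjugate module B acts on the left and A on the right through their involutions, and the
    two inner products trade places; [lp], conjugate linear in its second variable, becomes linear
    there. *)
Lemma conj_morita_context : @morita_context R B A (conj_module X)
  (fun b x => ra x (cstar b)) (fun x a => la (cstar a) x) rp lp.
Proof.
split.
- by move=> c a b x; rewrite cstarD cstarZ linearPr.
- by move=> c a x y; rewrite linearPl.
- by move=> a b x; rewrite cstarM (rh_actA hr).
- by move=> c x a b; rewrite cstarD cstarZ linearPl.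
- by move=> x a b; rewrite cstarM (lh_actA hl).
- by move=> a x b; rewrite ib_actA.
- move=> c x y z; transitivity (((c^*)^*)%C *: lp x y + lp x z).
    exact: linearPr.
  by rewrite conjcK.
- exact: lh_ip_star hl.
- move=> x y b; rewrite -(lh_ip_star hl) (lh_ip_act hl) cstarM cstarK.
  by rewrite (lh_ip_star hl).
- exact: lh_ip_ge0 hl.
- by move=> a x y; rewrite lip_ract.
- by move=> x y z; rewrite (rh_ip_star hr) (lh_ip_star hl) ib_ipA.
move=> S S0 Slin Scl Slp; apply: dense_span_ind (lh_full hl) S0 Slin Scl _.
by move=> _ [z _ <-].
Qed.

End ImprimitivityBimodule.

Theorem proposition2 (R : realType) (A B : cstarAlgebra R)
    (X : imprimitivityBimodule A B) :
  liminary A <-> liminary B.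
Proof.
split.
  exact: morita_liminary (bimodule_morita_context X).
exact: morita_liminary (conj_morita_context X).
Qed.
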